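(* Suppose Assumptions 1 and 2 (stated in the context) hold, let $p>L_f$ and $\alpha>0$, and choose $B$ such that $$B>\max\Big\{\frac{4\nabla_fD_X+2pD_X^2}{\Delta_0},\ \frac{2\nabla_f+2pD_X}{\sigma_{X^*}}\Big\}.$$ There exists a constant $\delta>0$ such that, for the iterates of the algorithm SPLM with these $p,\alpha,B$ (and any $c>0$, any $\beta\in(0,1/(24\kappa_1)]$, any admissible starting point) and every $t\in\mathbb{N}$: if $\max\{\|y^t-y_+^t(z^t)\|,\|z^t-x(z^t)\|\}\le\delta$, then $$\|x(y_+^t(z^t),z^t)-x(z^t)\|\le\kappa_5\|y^t-y_+^t(z^t)\|,$$ where $$\kappa_5:=\frac{2\left(L_f+p+(2\nabla_f+2pD_X)\sigma_{X^*}^{-1}\sqrt{L_h^2+L_g^2}\right)\left(\frac1\alpha+K_h\kappa_2\right)}{\mu_K\sigma_{X^*}}.$$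
   Context: Problem: $\min_{x\in X}\{f(x):h(x)\le 0\}$, with $f:\mathbb{R}^n\to\mathbb{R}$, $h=(h_1,\dots,h_m):\mathbb{R}^n\to\mathbb{R}^m$, $X=\{x\in\mathbb{R}^n: g(x)\le 0\}$, $g=(g_1,\dots,g_l):\mathbb{R}^n\to\mathbb{R}^l$ (inequalities componentwise). $\|\cdot\|$ is the Euclidean norm, $\Pi_C$ the Euclidean projection onto $C$, $N_X(x)$ the normal cone of $X$ at $x$, $[m]=\{1,\dots,m\}$, $\mathbb{N}$ the nonnegative integers, and $\nabla h(x)\in\mathbb{R}^{m\times n}$ has rows $\nabla h_i(x)^\top$. Assumption 1: (1) $X$ is convex and compact; each $g_j$ is convex and differentiable with $\|\nabla g_j(u)-\nabla g_j(v)\|\le L_{g_j}\|u-v\|$ for all $u,v\in\mathbb{R}^n$. (2) $f$ is continuously differentiable over $X$ and $\|\nabla f(u)-\nabla f(v)\|\le L_f\|u-v\|$ for all $u,v\in X$, with $L_f>0$. (3) Each $h_i$ is convex and continuously differentiable over $X$ with $\|\nabla h_i(u)-\nabla h_i(v)\|\le L_{h_i}\|u-v\|$ for all $u,v\in X$. Constants: $\nabla_f=\max_{x\in X}\|\nabla f(x)\|$, $D_X=\max_{u,v\in X}\|u-v\|$, $L_h=(\sum_i L_{h_i}^2)^{1/2}$, $L_g=(\sum_j L_{g_j}^2)^{1/2}$, $K_{h_i}=\max_{x\in X}\|\nabla h_i(x)\|$, $K_h=(\sum_i K_{h_i}^2)^{1/2}$, all assumed strictly positive. Stationary point: $x\in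 X$ such that there is $y\in\mathbb{R}^m_+$ with $0\in\nabla f(x)+\nabla h(x)^\top y+N_X(x)$, $h(x)\le0$, $\langle y,h(x)\rangle=0$. $X^*$ is the set of stationary points. Active set: $A[x]=\{i\in[m]:h_i(x)=0\}\cup\{m+j: j\in[l],\,g_j(x)=0\}\subseteq[m+l]$. $J(x)\in\mathbb{R}^{(m+l)\times n}$ is the matrix with rows $\nabla h_1(x)^\top,\dots,\nabla h_m(x)^\top,\nabla g_1(x)^\top,\dots,\nabla g_l(x)^\top$; $J_{\mathcal S}(x)$ is the submatrix of rows in $\mathcal S\subseteq[m+l]$. Assumption 2: (1) There are $\hat x\in X$ and $\Delta_0>0$ with $h_i(\hat x)\le-\Delta_0$ for all $i\in[m]$. (2) $\sigma_{X^*}:=\inf\{\sigma_{\min}(J_{\mathcal S}(x^* )^\top): x^*\in X^*,\ \emptyset\neq\mathcal S\subseteq A[x^*]\}>0$, where $\sigma_{\min}(J_{\mathcal S}(x^* )^\top)$ is the smallest singular value of $J_{\mathcal S}(x^* )^\top$ (so $\|J_{\mathcal S}(x^* )^\top v\|\ge\sigma_{X^*}\|v\|$ for all $v$). Notation: $Y=[0,B]^m$, $\mu_K=p-L_f$, $\kappa_1=p/\mu_K$, $\kappa_2=K_h/\mu_K$, $K(x,z;y)=f(x)+\langle y,h(x)\rangle+\frac p2\|x-z\|^2$, $x(y,z)=\arg\min_{x\in X}K(x,z;y)$, $x(z)=\arg\min_{x\in X}\max_{y\in Y}K(x,z;y)$. Algorithm SPLM with parameters $(\alpha,\beta,c,p,B)$: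 start from $x^0\in X$, $z^0\in X$, $y^0\in Y$; for $t=0,1,2,\dots$: $x^{t+1}=\Pi_X(x^t-c\nabla_xK(x^t,z^t;y^t))$, $y^{t+1}=\Pi_Y(y^t+\alpha h(x^{t+1}))$, $z^{t+1}=z^t+\beta(x^{t+1}-z^t)$. Write $y_+^t(z^t)=\Pi_Y(y^t+\alpha h(x(y^t,z^t)))$. *)

(* Defs.v *)
From mathcomp Require Export all_boot all_order all_algebra.
From mathcomp Require Export all_classical all_reals all_analysis.

Set Implicit Arguments.
Unset Strict Implicit.
Unset Printing Implicit Defensive.

Export Order.TTheory GRing.Theory Num.Theory.
Export numFieldNormedType.Exports.

Local Open Scope classical_set_scope.
Local Open Scope ring_scope.

(* R^n is 'rV[R]_n.  The norm `|_| of the library on 'rV[R]_n is the sup norm: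
   it induces the same topology and differentials as the Euclidean norm, but
   all quantitative statements below use [enorm]. *)
Definition dot (R : realType) (n : nat) (u v : 'rV[R]_n) : R :=
  \sum_(i < n) u 0 i * v 0 i.

Definition enorm (R : realType) (n : nat) (u : 'rV[R]_n) : R :=
  Num.sqrt (dot u u).

Definition grad (R : realType) (n : nat) (F : 'rV[R]_n -> R) (x : 'rV[R]_n) :
    'rV[R]_n :=
  \row_(j < n) 'D_(delta_mx 0 j) F x.

Definition component (R : realType) (n m : nat) (F : 'rV[R]_n -> 'rV[R]_m)
    (i : 'I_m) (x : 'rV[R]_n) : R := F x 0 i.

Definition gradmx (R : realType) (n m : nat) (F : 'rV[R]_n -> 'rV[R]_m)
    (x : 'rV[R]_n) : 'M[R]_(m, n) :=
  \matrix_(i < m) grad (component F i) x.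

(* A minimizer of F over A, and 0 when there is none.  It is used only for
   functions having exactly one minimizer over A. *)
Definition argmin (R : realType) (n : nat) (A : set 'rV[R]_n)
    (F : 'rV[R]_n -> R) : 'rV[R]_n :=
  xget 0 [set x | A x /\ forall u, A u -> F x <= F u].

Definition euclid_proj (R : realType) (n : nat) (C : set 'rV[R]_n) (x : 'rV[R]_n) :
    'rV[R]_n :=
  argmin C (fun u => enorm (u - x)).

Definition normal_cone (R : realType) (n : nat) (C : set 'rV[R]_n)
    (x : 'rV[R]_n) : set 'rV[R]_n :=
  [set v | C x /\ forall u, C u -> dot v (u - x) <= 0].

Definition lipschitz_grad (R : realType) (n : nat) (C : set 'rV[R]_n) (L : R)
    (F : 'rV[R]_n -> R) : Prop :=
  forall u v, C u -> C v -> enorm (grad F u - grad F v) <= L * enorm (u - v).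

(* Differentiability at a point of C is that of F as a function on R^n; only the
   continuity of the gradient is relative to C. *)
Definition cont_diff_over (R : realType) (n : nat) (C : set 'rV[R]_n)
    (F : 'rV[R]_n -> R) : Prop :=
  (forall x, C x -> differentiable F x) /\ {within C, continuous (grad F)}.

(* The singular values of an n x k matrix A are the square roots of the k
   eigenvalues of A^T A; when k > n one of them is therefore 0, so that
   |A v| >= sigma_min A * |v| holds for all v.  For k > 0 the set below is finite
   and nonempty, and the infimum is its least element. *)
Definition sigma_min (R : realType) (n k : nat) (A : 'M[R]_(n, k)) : R :=
  inf [set s : R | 0 <= s /\ eigenvalue (A^T *m A) (s ^+ 2)].

Section Problem.
Context {R : realType} {n m l : nat}.
Variables (f : 'rV[R]_n -> R) (h : 'rV[R]_n -> 'rV[R]_m)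
  (g : 'rV[R]_n -> 'rV[R]_l).

Definition feasX : set 'rV[R]_n := [set x | forall j, g x 0 j <= 0].

Definition assumption1 (Lf : R) (Lh : 'I_m -> R) (Lg : 'I_l -> R) : Prop :=
  [/\ [/\ convex_set feasX, compact feasX &
          forall j, [/\ convex_function setT (component g j),
                        forall x, differentiable (component g j) x &
                        lipschitz_grad setT (Lg j) (component g j)]],
      [/\ cont_diff_over feasX f, lipschitz_grad feasX Lf f & 0 < Lf] &
      forall i, [/\ convex_function feasX (component h i),
                    cont_diff_over feasX (component h i) &
                    lipschitz_grad feasX (Lh i) (component h i)]].

(* The suprema are maxima, feasX being compact and nonempty. *)
Definition max_grad (F : 'rV[R]_n -> R) : R :=
  sup [set enorm (grad F x) | x in feasX].

Definition diamX : R := sup [set enorm (u.1 - u.2) | u in feasX `*` feasX].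

Definition norm2 (k : nat) (a : 'I_k -> R) : R :=
  Num.sqrt (\sum_(i < k) a i ^+ 2).

Definition Kh : R := norm2 (fun i => max_grad (component h i)).

Definition constants_pos (Lh : 'I_m -> R) (Lg : 'I_l -> R) : Prop :=
  [/\ 0 < max_grad f, 0 < diamX, 0 < norm2 Lh /\ 0 < norm2 Lg,
      forall i, 0 < max_grad (component h i) & 0 < Kh].

Definition stationary (x : 'rV[R]_n) : Prop :=
  feasX x /\
  exists y : 'rV[R]_m,
    [/\ forall i, 0 <= y 0 i,
        exists2 v, normal_cone feasX x v & grad f x + y *m gradmx h x + v = 0,
        forall i, h x 0 i <= 0 &
        dot y (h x) = 0].

Definition active (x : 'rV[R]_n) : {set 'I_(m + l)} :=
  ([set lshift l i | i : 'I_m & h x 0%R i == 0%R] :|: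
   [set rshift m j | j : 'I_l & g x 0%R j == 0%R])%SET.

Definition Jmx (x : 'rV[R]_n) : 'M[R]_(m + l, n) :=
  col_mx (gradmx h x) (gradmx g x).

Definition Jsub (S : {set 'I_(m + l)}) (x : 'rV[R]_n) : 'M[R]_(#|S|, n) :=
  rowsub (fun k : 'I_#|S| => enum_val k) (Jmx x).

(* The infimum is taken in the extended reals: it is +oo when no constraint is
   active at any stationary point. *)
Definition sigma_star : \bar R :=
  ereal_inf [set s | exists x (S : {set 'I_(m + l)}),
    [/\ stationary x, S != finset.set0, S \subset active x &
        s = (sigma_min (Jsub S x)^T)%:E]].

(* 0 when sigma_star = +oo *)
Definition inv_sigma_star : R := fine (sigma_star^-1)%E.

Definition assumption2 (xhat : 'rV[R]_n) (Delta0 : R) : Prop :=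
  [/\ feasX xhat, 0 < Delta0, forall i, h xhat 0 i <= - Delta0 &
      (0 < sigma_star)%E].

Definition boxY (B : R) : set 'rV[R]_m := [set y | forall i, 0 <= y 0 i <= B].

Definition Kfun (p : R) (x z : 'rV[R]_n) (y : 'rV[R]_m) : R :=
  f x + dot y (h x) + p / 2 * enorm (x - z) ^+ 2.

Definition x_yz (p : R) (y : 'rV[R]_m) (z : 'rV[R]_n) : 'rV[R]_n :=
  argmin feasX (fun x => Kfun p x z y).

Definition x_z (p B : R) (z : 'rV[R]_n) : 'rV[R]_n :=
  argmin feasX (fun x => sup [set Kfun p x z y | y in boxY B]).

Definition y_plus (p B alpha : R) (y : 'rV[R]_m) (z : 'rV[R]_n) : 'rV[R]_m :=
  euclid_proj (boxY B) (y + alpha *: h (x_yz p y z)).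

Definition SPLM (alpha beta c p B : R)
    (x z : nat -> 'rV[R]_n) (y : nat -> 'rV[R]_m) : Prop :=
  [/\ feasX (x 0%N), feasX (z 0%N), boxY B (y 0%N) &
      forall t : nat,
        [/\ x t.+1 =
              euclid_proj feasX (x t - c *: grad (fun u => Kfun p u (z t) (y t)) (x t)),
            y t.+1 = euclid_proj (boxY B) (y t + alpha *: h (x t.+1)) &
            z t.+1 = z t + beta *: (x t.+1 - z t)]].

Definition mu_K (Lf p : R) : R := p - Lf.
Definition kappa1 (Lf p : R) : R := p / mu_K Lf p.
Definition kappa2 (Lf p : R) : R := Kh / mu_K Lf p.

Definition kappa5 (Lf : R) (Lh : 'I_m -> R) (Lg : 'I_l -> R) (p alpha : R) : R :=
  2 * (Lf + p + (2 * max_grad f + 2 * p * diamX) * inv_sigma_star *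
         Num.sqrt (norm2 Lh ^+ 2 + norm2 Lg ^+ 2)) *
    (1 / alpha + Kh * kappa2 Lf p) / mu_K Lf p * inv_sigma_star.

End Problem.

(* Main.v *)
Require Import Defs.
From mathcomp Require Import ring lra.

(** Write x+ = x(y+, z) and let y* be a multiplier making (x(z), y* ) a saddle point
    of K(., z; .) over X times the box Y.

    Strong monotonicity.  The Lipschitz gradient of f, the convexity of h and the
    regularization p make the first-order optimality conditions in x strongly
    monotone with constant mu = p - L_f ([optimality_monotone]).  As y+ is one projected
    gradient step away from y, it is a best response to x+ up to an error of
    order |y - y+|, and comparison with the saddle point gives
      mu |x+ - x(z)|^2 <= |y+ - y*| (1/alpha + K_h kappa_2) |y - y+|
    ([residual_bound]).  Saddle points exist because the dual function attains its
    maximum on the box ([saddle_exists]), and x(z) is their primal part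
    ([x_z_saddle]).

    Regularity.  It remains to bound |y+ - y*| by a multiple of |x+ - x(z)|, which
    holds when both points are close to a stationary point xb.  There the multipliers
    vanish outside the constraints active at xb, and the normal vector of X in
    each optimality condition is a combination of active gradients of g, by
    their linear independence ([normal_cone_span]).  The Jacobian being Lipschitz, it
    keeps half of its smallest singular value near xb
    ([near_supported_enorm_le]).  The difference of the two optimality conditions then
    yields the bound, and one factor |x+ - x(z)| cancels
    ([error_bound_near_stationary]).

    Localization.  By compactness of X it is enough to find delta near each xb in X
    ([error_bound_near]).  If xb differs from x(xb), the residual |z - x(z)|
    is bounded away from 0 near xb.  If xb = x(xb), the Slater point and the size of B
    force every saddle multiplier at xb to be strictly below B, so xb satisfies
    h <= 0 and is stationary ([saddle_fixpoint_stationary]); as z tends to xb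
    and delta to 0, the points x(z), x+ and x(y, z) all tend to xb.

    When no constraint is active at any stationary point, sigma_star = +oo and
    kappa_5 = 0.  The same argument applies, since a vector supported on an empty active
    set vanishes ([supported_enorm_le]). *)

Set Implicit Arguments.
Unset Strict Implicit.
Unset Printing Implicit Defensive.

Local Open Scope classical_set_scope.
Local Open Scope ring_scope.

(** * Euclidean geometry of row vectors *)

Section Euclid.
Context {R : realType} {n : nat}.
Implicit Types (u v w : 'rV[R]_n) (a : R).

Lemma dotE u v : dot u v = (u *m v^T) 0 0.
Proof. by rewrite mxE; apply: eq_bigr => i _; rewrite mxE. Qed.

Lemma dotC u v : dot u v = dot v u.
Proof. by apply: eq_bigr => i _; rewrite mulrC. Qed.

Lemma dotDl u v w : dot (u + v) w = dot u w + dot v w.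
Proof. by rewrite !dotE mulmxDl mxE. Qed.

Lemma dotNl u v : dot (- u) v = - dot u v.
Proof. by rewrite !dotE mulNmx mxE. Qed.

Lemma dotZl a u v : dot (a *: u) v = a * dot u v.
Proof. by rewrite !dotE -scalemxAl mxE. Qed.

Lemma dotDr u v w : dot w (u + v) = dot w u + dot w v.
Proof. by rewrite ![dot w _]dotC dotDl. Qed.

Lemma dotNr u v : dot v (- u) = - dot v u.
Proof. by rewrite ![dot v _]dotC dotNl. Qed.

Lemma dotZr a u v : dot v (a *: u) = a * dot v u.
Proof. by rewrite ![dot v _]dotC dotZl. Qed.

Lemma dotBl u v w : dot (u - v) w = dot u w - dot v w.
Proof. by rewrite dotDl dotNl. Qed.

Lemma dotBr u v w : dot w (u - v) = dot w u - dot w v.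
Proof. by rewrite dotDr dotNr. Qed.

Lemma dot0l u : dot 0 u = 0.
Proof. by rewrite -(scale0r u) dotZl mul0r. Qed.

Lemma dot0r u : dot u 0 = 0.
Proof. by rewrite dotC dot0l. Qed.

Lemma dot_ge0 u : 0 <= dot u u.
Proof. by apply: sumr_ge0 => i _; rewrite -expr2 sqr_ge0. Qed.

Lemma enorm_ge0 u : 0 <= enorm u.
Proof. exact: sqrtr_ge0. Qed.

Lemma sqr_enorm u : enorm u ^+ 2 = dot u u.
Proof. exact/sqr_sqrtr/dot_ge0. Qed.

Lemma enorm_sqrD u v : enorm (u + v) ^+ 2 = enorm u ^+ 2 + 2 * dot u v + enorm v ^+ 2.
Proof. rewrite !sqr_enorm dotDl !dotDr (dotC v u); ring. Qed.

Lemma enorm_eq0 u : (enorm u == 0) = (u == 0).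
Proof.
apply/idP/eqP => [/eqP u0|->]; last by rewrite /enorm dot0l sqrtr0.
have /eqP : dot u u = 0 by rewrite -sqr_enorm u0 expr0n.
rewrite psumr_eq0 => [/allP s0|i _]; last by rewrite -expr2 sqr_ge0.
apply/rowP => i; rewrite mxE; apply/eqP.
by have := s0 i (mem_index_enum _); rewrite -expr2 sqrf_eq0.
Qed.

Lemma enorm0 : enorm (0 : 'rV[R]_n) = 0.
Proof. by apply/eqP; rewrite enorm_eq0. Qed.

Lemma enormZ a u : enorm (a *: u) = `|a| * enorm u.
Proof.
by rewrite /enorm dotZl dotZr mulrA -expr2 sqrtrM ?sqr_ge0// sqrtr_sqr.
Qed.

Lemma enormN u : enorm (- u) = enorm u.
Proof. by rewrite /enorm dotNl dotNr opprK. Qed.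

Lemma enormB u v : enorm (u - v) = enorm (v - u).
Proof. by rewrite -enormN opprB. Qed.

Lemma CauchySchwarz u v : dot u v <= enorm u * enorm v.
Proof.
have [->|u0] := eqVneq u 0; first by rewrite dot0l mulr_ge0 ?enorm_ge0.
have [->|v0] := eqVneq v 0; first by rewrite dot0r mulr_ge0 ?enorm_ge0.
have up : 0 < enorm u by rewrite lt_neqAle enorm_ge0 andbT eq_sym enorm_eq0.
have vp : 0 < enorm v by rewrite lt_neqAle enorm_ge0 andbT eq_sym enorm_eq0.
have := dot_ge0 (enorm v *: u - enorm u *: v).
have -> : dot (enorm v *: u - enorm u *: v) (enorm v *: u - enorm u *: v) =
    2 * (enorm u * enorm v) * (enorm u * enorm v - dot u v).
  rewrite dotBl !dotBr !dotZl !dotZr -!sqr_enorm (dotC v u); ring.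
by rewrite pmulr_rge0 ?mulr_gt0// subr_ge0.
Qed.

Lemma CauchySchwarz_norm u v : `|dot u v| <= enorm u * enorm v.
Proof.
rewrite ler_norml CauchySchwarz andbT lerNl -dotNl -(enormN u).
exact: CauchySchwarz.
Qed.

Lemma enormD u v : enorm (u + v) <= enorm u + enorm v.
Proof.
rewrite -(ler_pXn2r (ltn0Sn 1)) ?nnegrE ?addr_ge0 ?enorm_ge0//.
by rewrite enorm_sqrD; have := CauchySchwarz u v; nra.
Qed.

Lemma enorm_triangle v u w : enorm (u - w) <= enorm (u - v) + enorm (v - w).
Proof. by rewrite -[u - w](subrKA v) enormD. Qed.

Lemma coord_le_enorm u i : `|u 0 i| <= enorm u.
Proof.
rewrite -sqrtr_sqr ler_sqrt ?dot_ge0// /dot (bigD1 i)//= -expr2 lerDl.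
by apply: sumr_ge0 => j _; rewrite -expr2 sqr_ge0.
Qed.

Lemma norm_le_enorm u : `|u| <= enorm u.
Proof.
rewrite /Num.norm/= mx_normrE.
by apply/bigmax_leP; split=> [|[i j] _]/=; rewrite ?enorm_ge0// ord1 coord_le_enorm.
Qed.

Lemma continuous_dot (F G : 'rV[R]_n -> 'rV[R]_n) u :
  {for u, continuous F} -> {for u, continuous G} ->
  {for u, continuous (fun x => dot (F x) (G x))}.
Proof.
move=> cF cG.
have cc (H : 'rV[R]_n -> 'rV[R]_n) i :
    {for u, continuous H} -> {for u, continuous (fun x => H x 0 i)}.
  by move=> cH; apply: (@continuous_comp _ _ _ H (fun x => x 0 i)) => //;
    exact: coord_continuous.
apply: (@cvg_big _ _ _ _ _ (@add_continuous R^o) _ (nbhs u)) => i _.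
by apply: cvgM; exact: cc.
Qed.

Lemma continuous_enorm v : continuous (fun u => enorm (u - v)).
Proof.
move=> u; have cd : {for u, continuous (fun x : 'rV[R]_n => dot (x - v) (x - v))}.
  have cB : {for u, continuous (fun x : 'rV[R]_n => x - v)}.
    apply: (@continuousB _ _ _ id (cst v) u);
      [exact: cvg_id|exact: cst_continuous].
  exact: continuous_dot.
exact: (cvg_comp _ _ cd (@sqrt_continuous R _)).
Qed.

Lemma near_enorm v (e : R) : 0 < e -> \forall u \near v, enorm (u - v) < e.
Proof.
move=> e0; have := @continuous_enorm v v.
by rewrite /continuous_at subrr enorm0 => /cvgr_lt; apply.
Qed.

Lemma enorm_nbhs v (P : set 'rV[R]_n) : (\forall u \near v, P u) ->
  exists2 e : R, 0 < e & forall u, enorm (u - v) < e -> P u.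
Proof.
move=> /nbhs_normP[e /= e0 sub]; exists e => // u ue; apply: sub => /=.
by rewrite distrC; exact: le_lt_trans (norm_le_enorm _) ue.
Qed.

Lemma lipschitz_enorm_continuous (F : 'rV[R]_n -> R) M :
  (forall u v, F u - F v <= M * enorm (u - v)) -> continuous F.
Proof.
move=> FM v; have M0 : 0 < `|M| + 1 by rewrite ltr_wpDl.
have le u w : F u - F w <= (`|M| + 1) * enorm (u - w).
  apply: (le_trans (FM _ _)); rewrite ler_wpM2r ?enorm_ge0//.
  by rewrite (le_trans (ler_norm _))// lerDl.
apply/(@cvgrPdist_lt _ R^o _ (nbhs v)) => e e0.
near=> u; have ue : enorm (u - v) < e / (`|M| + 1).
  by near: u; apply: near_enorm; rewrite divr_gt0.
rewrite ltr_pdivlMr// mulrC in ue.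
rewrite ltr_norml; have := le u v; have := le v u; rewrite (enormB v u).
by move: ue; lra.
Unshelve. all: by end_near. Qed.

End Euclid.
Lemma dot_mulmx (R : realType) (n k : nat) (u : 'rV[R]_n) (A : 'M[R]_(n, k)) v :
  dot (u *m A) v = dot u (v *m A^T).
Proof. by rewrite !dotE trmx_mul trmxK mulmxA. Qed.

(** The Frobenius norm dominates the operator norm. *)
Lemma enorm_mulmx_le (R : realType) (n k : nat) (u : 'rV[R]_k) (A : 'M[R]_(k, n)) :
  enorm (u *m A) <= enorm u * norm2 (fun i => enorm (row i A)).
Proof.
have [->|] := eqVneq (u *m A) 0.
  by rewrite enorm0 mulr_ge0 ?enorm_ge0 ?sqrtr_ge0.
rewrite -enorm_eq0 => w0.
have wp : 0 < enorm (u *m A) by rewrite lt_neqAle enorm_ge0 andbT eq_sym.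
rewrite -(ler_pM2l wp) -expr2 sqr_enorm.
pose b : 'rV[R]_k := \row_i enorm (row i A).
have nb : norm2 (fun i => enorm (row i A)) = enorm b.
  by rewrite /norm2/enorm; congr Num.sqrt; apply: eq_bigr => i _; rewrite mxE expr2.
pose c : 'rV[R]_k := (u *m A) *m A^T.
have -> : dot (u *m A) (u *m A) = dot u c by rewrite dot_mulmx.
apply: (le_trans (CauchySchwarz _ _)).
rewrite nb mulrCA ler_wpM2l ?enorm_ge0//.
rewrite -(ler_pXn2r (ltn0Sn 1)) ?nnegrE ?mulr_ge0 ?enorm_ge0//.
rewrite exprMn !sqr_enorm mulr_sumr; apply: ler_sum => i _.
rewrite -[_ * _]expr2 [c _ _](_ : _ = dot (u *m A) (row i A)); last first.
  by rewrite /c mxE; apply: eq_bigr => j _; rewrite !mxE.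
rewrite [b _ _]mxE -expr2 -sqr_enorm -exprMn -real_normK ?num_real//.
by rewrite ler_pXn2r ?nnegrE ?mulr_ge0 ?enorm_ge0// CauchySchwarz_norm.
Qed.

(** * The smallest singular value *)

Lemma quadratic_ge0_linear_eq0 (R : realFieldType) (a b : R) :
  (forall t, 0 <= 2 * t * a + t ^+ 2 * b) -> a = 0.
Proof.
move=> tab; have b0 : 0 <= b by have := tab 1; have := tab (-1); nra.
have := tab (- a / (b + 1)).
have -> : 2 * (- a / (b + 1)) * a + (- a / (b + 1)) ^+ 2 * b =
    - ((b + 2) * (a / (b + 1)) ^+ 2) by field; lra.
rewrite oppr_ge0 pmulr_rle0; last by lra.
rewrite real_exprn_even_le0 ?num_real//= mulf_eq0 invr_eq0 => /orP[/eqP//|/eqP]; lra.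
Qed.

Lemma compact_unit_sphere (R : realType) (k : nat) :
  compact [set w : 'rV[R]_k | enorm w = 1].
Proof.
apply: (@subclosed_compact _ _ [set w : 'rV[R]_k | forall i, w ord0 i \in `[-1, 1]]).
- rewrite (_ : [set _ | _] = (fun w : 'rV[R]_k => enorm (w - 0)) @^-1` [set 1]).
    by apply: closed_comp => [w _|]; [exact: continuous_enorm|exact: closed_eq].
  by apply/seteqP; split => w /=; rewrite subr0.
- by apply: (@rV_compact R k (fun=> `[-1, 1]%classic)) => _; exact: segment_compact.
- move=> w /= w1 i; rewrite in_itv/= -ler_norml -w1; exact: coord_le_enorm.
Qed.

(** A minimizer w0 of |w M| on the unit sphere is an eigenvector of M M^T, because
    the quadratic form |w M|^2 - |w0 M|^2 |w|^2 is nonnegative and vanishes at w0,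
    hence has zero gradient there; the minimum is thus one of the values over which
    [sigma_min] takes an infimum. *)
Lemma sigma_min_le (R : realType) (n k : nat) (M : 'M[R]_(k, n)) (w : 'rV[R]_k) :
  sigma_min M^T * enorm w <= enorm (w *m M).
Proof.
have [->|w0] := eqVneq w 0; first by rewrite mul0mx !enorm0 mulr0.
have wp : 0 < enorm w by rewrite lt_neqAle enorm_ge0 andbT eq_sym enorm_eq0.
have unit (u : 'rV[R]_k) : u != 0 -> enorm ((enorm u)^-1 *: u) = 1.
  rewrite -enorm_eq0 => u0; rewrite enormZ ger0_norm ?invr_ge0 ?enorm_ge0//.
  by rewrite mulVf.
have cM : continuous (fun u : 'rV[R]_k => enorm (u *m M)).
  apply: (@lipschitz_enorm_continuous _ _ _ (norm2 (fun i => enorm (row i M)))) => u v.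
  rewrite lerBlDr mulrC; have := enorm_mulmx_le (u - v) M.
  have := enormD ((u - v) *m M) (v *m M); rewrite -mulmxDl subrK; lra.
have S0 : [set u : 'rV[R]_k | enorm u = 1] !=set0.
  by exists ((enorm w)^-1 *: w); exact: unit.
have [u] := EVT_min_rV S0 (@compact_unit_sphere R k) (continuous_subspaceT cM).
rewrite inE/= => u1 umin.
set s := enorm (u *m M) in umin.
have s0 : 0 <= s by exact: enorm_ge0.
have sle v : s * enorm v <= enorm (v *m M).
  have [->|v0] := eqVneq v 0; first by rewrite mul0mx !enorm0 mulr0.
  have vp : 0 < enorm v by rewrite lt_neqAle enorm_ge0 andbT eq_sym enorm_eq0.
  have := umin ((enorm v)^-1 *: v); rewrite inE/= => /(_ (unit _ v0)).
  by rewrite -scalemxAl enormZ ger0_norm ?invr_ge0 ?enorm_ge0// mulrC ler_pdivlMr.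
have su : eigenvalue (M^T^T *m M^T) (s ^+ 2).
  apply/eigenvalueP; exists u; last first.
    by rewrite -enorm_eq0 u1 oner_eq0.
  rewrite trmxK; apply/eqP; rewrite -subr_eq0 -enorm_eq0 -sqrf_eq0 sqr_enorm.
  set d := _ - _.
  have dd : dot (u *m M) (d *m M) = dot u d * s ^+ 2 + dot d d.
    rewrite [dot d d](dotBl _ _ d) mulmxA dotZl (dotC (u *m M)) dot_mulmx (dotC d); ring.
  clearbody d.
  pose b := enorm (d *m M) ^+ 2 - s ^+ 2 * enorm d ^+ 2.
  apply/eqP/(@quadratic_ge0_linear_eq0 _ _ b) => t; rewrite /b.
  have : s ^+ 2 * enorm (u + t *: d) ^+ 2 <= enorm ((u + t *: d) *m M) ^+ 2.
    rewrite -exprMn ler_pXn2r ?nnegrE ?mulr_ge0 ?enorm_ge0//.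
  rewrite mulmxDl -scalemxAl !enorm_sqrD !enormZ !exprMn real_normK ?num_real//.
  rewrite -/s u1 !dotZr dd.
  lra.
apply: le_trans (sle w); rewrite ler_wpM2r ?enorm_ge0//.
by apply: ge_inf; [exists 0 => y/= []|].
Qed.

(** * One-sided directional derivatives and convexity *)

Section Slope.
Context {R : realType} {n : nat}.
Implicit Types (F G : 'rV[R]_n -> R) (x u v z : 'rV[R]_n) (a b : R).

(** A one-sided derivative suffices for the inequalities below, which are obtained by
    moving from x into a convex set. *)
Definition slope F x v a :=
  (fun t : R => t^-1 * (F (x + t *: v) - F x)) t @[t --> 0^'+] --> a.

Lemma slope_grad F x v : differentiable F x -> slope F x v (dot (grad F x) v).
Proof.
move=> dF; have cF := @diff_derivable _ _ _ _ x v dF; rewrite /derivable in cF.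
have Ed : 'D_v F x = dot (grad F x) v.
  rewrite deriveE// [in LHS](row_sum_delta v) linear_sum/=.
  apply: eq_bigr => i _; rewrite linearZ/= mxE -deriveE//.
  by rewrite -[_ *: _]/(_ * _) mulrC.
rewrite -Ed; apply: cvg_dnbhs_at_right.
rewrite (_ : (fun t => _) = (fun t : R => t^-1 *: ((F \o shift x) (t *: v) - F x))).
  exact: cF.
by apply/funext => t /=; rewrite [x + _]addrC.
Qed.

Lemma slopeD F G x v a b : slope F x v a -> slope G x v b ->
  slope (fun u => F u + G u) x v (a + b).
Proof.
rewrite /slope => Fa Gb; under eq_fun do rewrite opprD addrACA mulrDr.
exact: (@cvgD _ R^o).
Qed.

Lemma slopeZ F x v a b : slope F x v a -> slope (fun u => b * F u) x v (b * a).
Proof.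
rewrite /slope => Fa; under eq_fun do rewrite -mulrBr mulrCA.
exact: (@cvgMl_tmp _ _ _ _ _ b _ Fa).
Qed.

Lemma slope_sum k (F : 'I_k -> 'rV[R]_n -> R) x v (a : 'I_k -> R) :
  (forall i, slope (F i) x v (a i)) ->
  slope (fun u => \sum_i F i u) x v (\sum_i a i).
Proof.
rewrite /slope => Fa.
under eq_fun do rewrite -sumrB mulr_sumr.
by apply: (@cvg_big _ _ _ _ _ (@add_continuous R^o)) => i _; exact: Fa.
Qed.

Lemma slope_sqr_enorm x v z :
  slope (fun u => enorm (u - z) ^+ 2) x v (2 * dot (x - z) v).
Proof.
rewrite /slope.
suff : (fun t : R => 2 * dot (x - z) v + t * enorm v ^+ 2) t @[t --> 0^'+] -->
    2 * dot (x - z) v + 0 * enorm v ^+ 2.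
  rewrite mul0r addr0; apply: cvg_trans; apply: near_eq_cvg; near=> t.
  have t0 : 0 < t by near: t; exact: nbhs_right_gt.
  rewrite [x + _ - z]addrAC [enorm (_ + t *: v) ^+ 2]enorm_sqrD dotZr enormZ.
  rewrite exprMn real_normK ?num_real//.
  by field; rewrite gt_eqF.
apply: (@cvgD _ R^o); first exact: cvg_cst.
apply: (@cvgM R _ _ _ id (cst _)); last exact: cvg_cst.
by apply: cvg_at_right_filter; exact: cvg_id.
Unshelve. all: by end_near. Qed.

Lemma slope_ge F x v a b : slope F x v a ->
  (forall t, 0 < t -> t <= 1 -> t * b <= F (x + t *: v) - F x) -> b <= a.
Proof.
move=> Fa Fb; apply: (cvgr_to_ge Fa); near=> t.
have t0 : 0 < t by near: t; exact: nbhs_right_gt.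
by rewrite mulrC ler_pdivlMr// mulrC Fb//; near: t; exact: nbhs_right_le.
Unshelve. all: by end_near. Qed.

Lemma slope_le F x v a b : slope F x v a ->
  (forall t, 0 < t -> t <= 1 -> F (x + t *: v) - F x <= t * b) -> a <= b.
Proof.
move=> Fa Fb; apply: (cvgr_to_le Fa); near=> t.
have t0 : 0 < t by near: t; exact: nbhs_right_gt.
by rewrite mulrC ler_pdivrMr// mulrC Fb//; near: t; exact: nbhs_right_le.
Unshelve. all: by end_near. Qed.

Lemma convex_set_segment (A : set 'rV[R]_n) x u t : convex_set A ->
  A x -> A u -> 0 <= t -> t <= 1 -> A (x + t *: (u - x)).
Proof.
move=> cA Ax Au t0 t1.
have At : A (t *: u + (1 - t) *: x).
  by have := cA u x (Itv01 t0 t1); rewrite !inE; apply.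
rewrite (_ : x + _ = t *: u + (1 - t) *: x)//.
by rewrite scalerBl scale1r scalerBr addrCA.
Qed.

Lemma convex_min_slope (A : set 'rV[R]_n) F x u a : convex_set A ->
  A x -> (forall u, A u -> F x <= F u) -> A u -> slope F x (u - x) a -> 0 <= a.
Proof.
move=> cA Ax xmin Au /slope_ge; apply => t t0 t1.
by rewrite mulr0 subr_ge0 xmin//; apply: convex_set_segment => //; exact: ltW.
Qed.

Lemma convex_gradient_le (A : set 'rV[R]_n) F x u :
  convex_function A F -> A x -> A u -> differentiable F x ->
  dot (grad F x) (u - x) <= F u - F x.
Proof.
move=> cF Ax Au dF; apply: (slope_le (slope_grad dF)) => t t0 t1.
have Ft : F (t *: u + (1 - t) *: x) <= t * F u + (1 - t) * F x.
  by have := cF (Itv01 (ltW t0) t1) u x; rewrite !inE; apply.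
rewrite (_ : x + _ = t *: u + (1 - t) *: x); first by lra.
by rewrite scalerBl scale1r scalerBr addrCA.
Qed.

End Slope.

(** * Normal cones under linear independence of the active gradients *)

Section Support.
Context {R : realType} {k n : nat}.
Implicit Types (S : {set 'I_k}) (w : 'rV[R]_k) (M : 'M[R]_(k, n)).

Definition supported_on S w := forall j, j \notin S -> w 0 j = 0.

Definition restrict S w : 'rV[R]_#|S| := \row_i w 0 (enum_val i).

Definition extend S (u : 'rV[R]_#|S|) : 'rV[R]_k :=
  u *m rowsub (fun i : 'I_#|S| => enum_val i) 1%:M.

Lemma supportedB S w w' :
  supported_on S w -> supported_on S w' -> supported_on S (w - w').
Proof. by move=> sw sw' j jS; rewrite !mxE sw ?sw' ?subrr. Qed.

Lemma restrict_mulmx S w M : supported_on S w ->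
  restrict S w *m rowsub (fun i : 'I_#|S| => enum_val i) M = w *m M.
Proof.
move=> sw; apply/rowP => c; rewrite !mxE [RHS](bigID (mem S))/= [X in _ + X]big1 ?addr0.
  by rewrite [RHS]big_enum_val; apply: eq_bigr => i _; rewrite !mxE.
by move=> j /sw ->; rewrite mul0r.
Qed.

Lemma enorm_restrict S w : supported_on S w -> enorm (restrict S w) = enorm w.
Proof.
move=> sw; congr Num.sqrt; rewrite /dot [RHS](bigID (mem S))/= [X in _ + X]big1 ?addr0.
  by rewrite [RHS]big_enum_val; apply: eq_bigr => i _; rewrite !mxE.
by move=> j /sw ->; rewrite mul0r.
Qed.

Lemma extend_supported S u : supported_on S (extend (S := S) u).
Proof.
move=> j jS; rewrite mxE big1// => i _; rewrite !mxE.
case: eqP => [ij|]; last by rewrite mulr0.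
by rewrite -ij enum_valP in jS.
Qed.

Lemma restrict_extend S u : restrict S (extend u) = u.
Proof.
apply/rowP => i; rewrite !mxE (bigD1 i)//= !mxE eqxx mulr1 big1 ?addr0// => j ji.
by rewrite !mxE (inj_eq enum_val_inj) (negbTE ji) mulr0.
Qed.

End Support.

Section NormalCone.
Context {R : realType} {n l : nat}.
Variables (g : 'rV[R]_n -> 'rV[R]_l) (x : 'rV[R]_n).
Hypothesis g_diff : forall j, differentiable (component g j) x.

Definition active_ineq : {set 'I_l} := [set j | g x 0%R j == 0%R]%SET.

(** A direction along which every active constraint strictly decreases is
    feasible for a short while, so normal vectors are nonpositive on it. *)
Lemma normal_cone_descent v d : normal_cone (feasX g) x v ->
  (forall j, j \in active_ineq -> dot (grad (component g j) x) d < 0) ->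
  dot v d <= 0.
Proof.
move=> [Xx vN] dneg.
suff [t t0 Xt] : exists2 t : R, 0 < t & feasX g (x + t *: d).
  have := vN _ Xt; rewrite addrC addKr dotZr; nra.
pose a j := dot (grad (component g j) x) d.
have near_le j : \forall t \near 0^'+, component g j (x + t *: d) <= 0.
  have sl : slope (component g j) x d (a j) := slope_grad (g_diff j).
  have Xj : component g j x <= 0 := Xx j.
  have [jA|jA] := boolP (j \in active_ineq).
    near=> t; have t0 : 0 < t by near: t; exact: nbhs_right_gt.
    have : t^-1 * (component g j (x + t *: d) - component g j x) < 0.
      near: t; apply: (cvgr_lt _ sl); exact: dneg.
    rewrite pmulr_rlt0 ?invr_gt0//; lra.
  have gj0 : component g j x < 0.
    by move: jA; rewrite inE lt_neqAle Xj andbT.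
  have q0 : 0 < `|a j| + 1 by rewrite ltr_wpDl.
  near=> t; have t0 : 0 < t by near: t; exact: nbhs_right_gt.
  have : t^-1 * (component g j (x + t *: d) - component g j x) < `|a j| + 1.
    near: t; apply: (cvgr_lt _ sl).
    by rewrite (le_lt_trans (ler_norm _))// ltrDl.
  rewrite ltr_pdivrMl// => tq.
  have ta : t < - component g j x / (`|a j| + 1).
    near: t; apply: nbhs_right_lt; by apply: divr_gt0; rewrite ?oppr_gt0.
  rewrite ltr_pdivlMr// in ta; lra.
have [t [t0 tX]] : exists t : R, 0 < t /\ forall j, component g j (x + t *: d) <= 0.
  apply: (@filter_ex _ (at_right (0 : R))); near=> t; split.
    by near: t; exact: nbhs_right_gt.
  by near: t; apply: filter_forall.
by exists t => // j; exact: tX.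
Unshelve. all: by end_near. Qed.

(** If v is normal and d is orthogonal to all active gradients, then d + e d0 is a
    feasible descent direction for every e > 0, where d0 decreases all active
    constraints at unit speed; letting e tend to 0, for d and for - d, shows
    that v is orthogonal to d.  Hence v is in the span of the active gradients. *)
Lemma normal_cone_span v :
  (forall w, supported_on active_ineq w -> w *m gradmx g x = 0 -> w = 0) ->
  normal_cone (feasX g) x v ->
  exists2 w, supported_on active_ineq w & v = w *m gradmx g x.
Proof.
move=> indep vN.
pose G := rowsub (fun i : 'I_#|active_ineq| => enum_val i) (gradmx g x).
have rowG i : row i G = grad (component g (enum_val i)) x.
  by apply/rowP => c; rewrite !mxE.
have dotG i (d : 'rV_n) : dot (row i G) d = (G *m d^T) i 0.
  by rewrite dotE -row_mul mxE.
have Gfree : row_free G.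
  apply: inj_row_free => u uG.
  rewrite -(restrict_extend u) (indep (extend u)).
  - by apply/rowP => i; rewrite !mxE.
  - exact: extend_supported.
  - by rewrite -(restrict_mulmx _ (@extend_supported _ _ _ u)) restrict_extend.
have [B GB] := row_freeP Gfree.
pose d0 : 'rV[R]_n := - (B *m const_mx 1)^T.
have Gd0 i : dot (row i G) d0 = -1.
  by rewrite dotG /d0 linearN/= trmxK mulmxN mulmxA GB mul1mx !mxE.
have orth (d : 'rV_n) : G *m d^T = 0 -> dot v d <= 0.
  move=> Gd; rewrite leNgt; apply/negP => vd.
  (* for this e, the term e <v, d0> offsets at most half of <v, d> *)
  pose e := dot v d / (2 * (`|dot v d0| + 1)).
  have q0 : 0 < `|dot v d0| + 1 by rewrite ltr_wpDl.
  have e0 : 0 < e by rewrite divr_gt0// mulr_gt0.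
  have : dot v (d + e *: d0) <= 0.
    apply: normal_cone_descent vN _ => j jA.
    have -> : grad (component g j) x = row (enum_rank_in jA j) G.
      by rewrite rowG enum_rankK_in.
    by rewrite dotDr dotZr Gd0 dotG Gd mxE add0r mulrN1 oppr_lt0.
  have : - dot v d0 <= `|dot v d0| + 1.
    by have := ler_norm (- dot v d0); rewrite normrN; lra.
  rewrite dotDr dotZr => le1.
  have : e * (- dot v d0) <= e * (`|dot v d0| + 1) by rewrite ler_pM2l.
  have -> : e * (`|dot v d0| + 1) = dot v d / 2 by rewrite /e; field; rewrite gt_eqF.
  lra.
have /submxP[u vE] : (v <= G)%MS.
  rewrite submxE; apply/eqP/rowP => c.
  pose d : 'rV[R]_n := (col c (cokermx G))^T.
  have Gd : G *m d^T = 0 by rewrite trmxK colE mulmxA mulmx_coker mul0mx.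
  have := orth d Gd; have := orth (- d); rewrite linearN/= mulmxN Gd oppr0 => /(_ erefl).
  rewrite dotNr => ? ?; rewrite [RHS]mxE.
  have -> : (v *m cokermx G) 0 c = dot v d.
    by rewrite dotE trmxK; move: (cokermx G) => C; rewrite colE mulmxA -colE [RHS]mxE.
  lra.
exists (extend u); first exact: extend_supported.
by rewrite -(restrict_mulmx _ (@extend_supported _ _ _ u)) restrict_extend.
Qed.

End NormalCone.

(** * Projections and boxes *)

Lemma argmin_spec (R : realType) (n : nat) (A : set 'rV[R]_n) (F : 'rV[R]_n -> R) :
  A !=set0 -> compact A -> {within A, continuous F} ->
  A (argmin A F) /\ forall u, A u -> F (argmin A F) <= F u.
Proof.
move=> A0 cA cF; have [c + cmin] := EVT_min_rV A0 cA cF; rewrite inE => Ac.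
rewrite /argmin; case: xgetP => [x _ //|/(_ c)[]].
by split => // u Au; apply: cmin; rewrite inE.
Qed.

Lemma euclid_proj_spec (R : realType) (n : nat) (C : set 'rV[R]_n) (a : 'rV[R]_n) :
  C !=set0 -> compact C -> convex_set C ->
  C (euclid_proj C a) /\
  forall u, C u -> dot (a - euclid_proj C a) (u - euclid_proj C a) <= 0.
Proof.
move=> C0 cC convC.
have [] := argmin_spec C0 cC (continuous_subspaceT (@continuous_enorm _ _ a)).
rewrite -/(euclid_proj C a) => Cp pmin; split => // u Cu.
have pmin2 v : C v -> enorm (euclid_proj C a - a) ^+ 2 <= enorm (v - a) ^+ 2.
  by move=> /pmin; rewrite ler_pXn2r ?nnegrE ?enorm_ge0.
have := convex_min_slope convC Cp pmin2 Cu (@slope_sqr_enorm _ _ _ _ _).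
rewrite -[in X in dot X _]opprB dotNl; lra.
Qed.

Lemma compact_enorm_bounded (R : realType) (m : nat) (A : set 'rV[R]_m) :
  compact A -> exists2 W : R, 0 <= W & forall u v, A u -> A v -> enorm (u - v) <= W.
Proof.
move=> cA; have [[a Aa]|A0] := pselect (A !=set0); last first.
  by exists 0 => // u v Au; case: A0; exists u.
have A0 : A !=set0 by exists a.
have [c _ cmax] := EVT_max_rV A0 cA (continuous_subspaceT (@continuous_enorm _ _ a)).
exists (2 * enorm (c - a)) => [|u v Au Av]; first by rewrite mulr_ge0 ?enorm_ge0.
have := cmax u; rewrite inE => /(_ Au); have := cmax v; rewrite inE => /(_ Av).
have := enorm_triangle a u v; rewrite (enormB a v); lra.
Qed.

Section Box.
Context {R : realType} {m : nat}.
Variable B : R.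
Hypothesis B_ge0 : 0 <= B.

Lemma boxY_compact : compact (boxY B : set 'rV[R]_m).
Proof.
rewrite (_ : boxY B = [set v : 'rV[R]_m | forall i, `[0, B]%classic (v ord0 i)]).
  by apply: (@rV_compact R m (fun=> `[0, B]%classic)) => _; exact: segment_compact.
by apply/seteqP; split => v /= vB i; have := vB i; rewrite in_itv.
Qed.

Lemma boxY_convex : convex_set (boxY B : set 'rV[R]_m).
Proof.
move=> u v t; rewrite !inE => uB vB i.
have -> : conv t u v = t%:num *: (u : 'rV[R]_m) + (1 - t%:num) *: (v : 'rV[R]_m) by [].
have := uB i; have := vB i; rewrite !mxE.
have t0 : 0 <= t%:num by []; have t1 : t%:num <= 1 by [].
move: (t%:num) (u 0 i) (v 0 i) t0 t1 => s a b s0 s1 /andP[b0 bB] /andP[a0 aB].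
by apply/andP; split; nra.
Qed.

Lemma boxY0 : boxY B (0 : 'rV[R]_m).
Proof. by move=> i; rewrite mxE lexx. Qed.

Definition update (y : 'rV[R]_m) i b : 'rV[R]_m :=
  \row_k if k == i then b else y 0 k.

Lemma boxY_update y i b : boxY B y -> 0 <= b <= B -> boxY B (update y i b).
Proof. by move=> yB bB k; rewrite mxE; case: ifP. Qed.

Lemma dot_update y i b v : dot v (update y i b) = dot v y + (b - y 0 i) * v 0 i.
Proof.
rewrite /dot (bigD1 i)//= [in RHS](bigD1 i)//= mxE eqxx.
rewrite (eq_bigr (fun k => v 0 k * y 0 k)); first ring.
by move=> k ki; rewrite mxE (negbTE ki).
Qed.

End Box.

(** * The constants of the problem *)

Section Constants.
Context {R : realType} {n l : nat}.
Variable g : 'rV[R]_n -> 'rV[R]_l.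
Hypothesis compactX : compact (feasX g).
Local Notation X := (feasX g).

Lemma enorm_le_diamX u v : X u -> X v -> enorm (u - v) <= diamX g.
Proof.
move=> Xu Xv; have [W _ XW] := compact_enorm_bounded compactX.
apply: ub_le_sup; last by exists (u, v).
by exists W => _ [[a b] [Xa Xb] <-]; exact: XW.
Qed.

Lemma enorm_le_max_grad (F : 'rV[R]_n -> R) L x :
  lipschitz_grad X L F -> X x -> enorm (grad F x) <= max_grad g F.
Proof.
move=> FL Xx; have [W W0 XW] := compact_enorm_bounded compactX.
apply: ub_le_sup; last by exists x.
exists (enorm (grad F x) + `|L| * W) => _ [u Xu <-].
have := enormD (grad F u - grad F x) (grad F x); rewrite subrK.
have := FL u x Xu Xx.
have : L * enorm (u - x) <= `|L| * W.
  apply: (@le_trans _ _ (`|L| * enorm (u - x))).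
    by rewrite ler_wpM2r ?enorm_ge0// ler_norm.
  by rewrite ler_wpM2l// XW.
lra.
Qed.

End Constants.

Lemma norm2_ge0 (R : realType) (k : nat) (a : 'I_k -> R) : 0 <= norm2 a.
Proof. exact: sqrtr_ge0. Qed.

Lemma sqr_norm2 (R : realType) (k : nat) (a : 'I_k -> R) :
  norm2 a ^+ 2 = \sum_i a i ^+ 2.
Proof. by rewrite sqr_sqrtr// sumr_ge0// => i _; exact: sqr_ge0. Qed.

Lemma norm2_le (R : realType) (k : nat) (a b : 'I_k -> R) :
  (forall i, `|a i| <= b i) -> norm2 a <= norm2 b.
Proof.
move=> ab; apply: ler_wsqrtr; apply: ler_sum => i _.
rewrite -(real_normK (num_real (a i))) ler_pXn2r ?nnegrE//.
exact: le_trans (ab i).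
Qed.

Lemma norm2M (R : realType) (k : nat) (a : 'I_k -> R) (c : R) :
  0 <= c -> norm2 (fun i => a i * c) = norm2 a * c.
Proof.
move=> c0; rewrite /norm2.
under eq_bigr do rewrite exprMn.
by rewrite -mulr_suml sqrtrM ?sumr_ge0// => [|i _]; rewrite ?sqrtr_sqr ?ger0_norm ?sqr_ge0.
Qed.

Lemma enorm_norm2 (R : realType) (k : nat) (u : 'rV[R]_k) :
  enorm u = norm2 (fun i => u 0 i).
Proof. by congr Num.sqrt; apply: eq_bigr => i _; rewrite expr2. Qed.

Lemma cancel_factor (R : realFieldType) (a c e : R) :
  0 <= c -> 0 <= e -> e ^+ 2 * a <= c * e -> e * a <= c.
Proof.
move=> c0; rewrite le_eqVlt => /predU1P[<-|e0]; first by rewrite mul0r.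
by rewrite expr2 -mulrA mulrC ler_pM2r.
Qed.

(** * The regularized Lagrangian *)

Section Lagrangian.
Context {R : realType} {n m l : nat}.
Variables (f : 'rV[R]_n -> R) (h : 'rV[R]_n -> 'rV[R]_m)
  (g : 'rV[R]_n -> 'rV[R]_l).
Variables (Lf : R) (Lh : 'I_m -> R) (Lg : 'I_l -> R) (p : R).
Hypothesis A1 : assumption1 f h g Lf Lh Lg.
Hypothesis X0 : feasX g !=set0.
Hypothesis p_gt : Lf < p.
Local Notation X := (feasX g).
Local Notation mu := (mu_K Lf p).
Local Notation Kh := (Kh h g).
Implicit Types (x z u : 'rV[R]_n) (y : 'rV[R]_m).

Let convexX : convex_set X. Proof. by case: A1 => [[]]. Qed.
Let compactX : compact X. Proof. by case: A1 => [[]]. Qed.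
Let f_diff x : X x -> differentiable f x.
Proof. by case: A1 => _ [[+ _] _ _] _; apply. Qed.
Let f_lip : lipschitz_grad X Lf f. Proof. by case: A1 => _ []. Qed.
Let h_diff i x : X x -> differentiable (component h i) x.
Proof. by case: A1 => _ _ /(_ i)[_ [+ _] _]; apply. Qed.
Let h_conv i : convex_function X (component h i).
Proof. by case: A1 => _ _ /(_ i)[]. Qed.
Let h_lip i : lipschitz_grad X (Lh i) (component h i).
Proof. by case: A1 => _ _ /(_ i)[]. Qed.
Lemma mu_gt0 : 0 < mu. Proof. by rewrite subr_gt0. Qed.
Lemma Lf_gt0 : 0 < Lf. Proof. by case: A1 => _ []. Qed.

Lemma h_lipschitz x u : X x -> X u -> enorm (h x - h u) <= Kh * enorm (x - u).
Proof.
move=> Xx Xu; rewrite enorm_norm2 -norm2M ?enorm_ge0//; apply: norm2_le => i.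
have le a b : X a -> X b ->
    h a 0 i - h b 0 i <= max_grad g (component h i) * enorm (a - b).
  move=> Xa Xb; have := convex_gradient_le (h_conv i) Xa Xb (h_diff i Xa).
  rewrite /component; have := CauchySchwarz (grad (component h i) a) (a - b).
  have := enorm_le_max_grad compactX (h_lip i) Xa.
  have := enorm_ge0 (a - b); rewrite -(opprB a b) dotNr; nra.
rewrite !mxE ler_norml le// andbT.
by have := le u x Xu Xx; rewrite (enormB u); lra.
Qed.

Definition optimality y z x := X x /\ forall u, X u ->
  0 <= dot (grad f x + y *m gradmx h x + p *: (x - z)) (u - x).

Lemma min_optimality y z x : X x ->
  (forall u, X u -> Kfun f h p x z y <= Kfun f h p u z y) -> optimality y z x.
Proof.
move=> Xx xmin; split => // u Xu.
apply: (convex_min_slope convexX Xx xmin Xu).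
have -> : dot (grad f x + y *m gradmx h x + p *: (x - z)) (u - x) =
    dot (grad f x) (u - x) + \sum_i y 0 i * dot (grad (component h i) x) (u - x) +
    p / 2 * (2 * dot (x - z) (u - x)).
  rewrite 2!dotDl dotZl mulrA divfK// dot_mulmx; congr (_ + _ + _).
  apply: eq_bigr => i _; congr (_ * _); rewrite mxE; apply: eq_bigr => j _.
  by rewrite !mxE mulrC.
apply: (@slopeD _ _ (fun u => f u + dot y (h u)) (fun u => p / 2 * enorm (u - z) ^+ 2)).
  apply: (@slopeD _ _ f (fun u => dot y (h u))); first exact/slope_grad/f_diff.
  apply: (@slope_sum _ _ _ (fun i u => y 0 i * component h i u)) => i.
  exact/slopeZ/slope_grad/h_diff.
apply: (@slopeZ _ _ (fun u => enorm (u - z) ^+ 2)); exact: slope_sqr_enorm.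
Qed.

Lemma continuous_Kfun y z : {within X, continuous (fun x => Kfun f h p x z y)}.
Proof.
apply: continuous_in_subspaceT => x; rewrite inE => Xx.
have cq : {for x, continuous (fun u : 'rV[R]_n => p / 2 * enorm (u - z) ^+ 2)}.
  apply: (@continuousM _ _ (cst (p / 2)) (fun u => enorm (u - z) ^+ 2));
    first exact: cst_continuous.
  apply: (@continuousM _ _ (fun u => enorm (u - z)) (fun u => enorm (u - z)));
    exact: continuous_enorm.
have ch : {for x, continuous (fun u => dot y (h u))}.
  apply: (@cvg_big _ _ _ _ _ (@add_continuous R^o) _ (nbhs x)) => i _.
  apply: (@continuousM _ _ (cst (y 0 i)) (component h i)); first exact: cst_continuous.
  exact/differentiable_continuous/h_diff.
have cf : {for x, continuous f} by exact/differentiable_continuous/f_diff.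
exact: (@continuousD _ R^o _ _ _ x (@continuousD _ R^o _ _ _ x cf ch) cq).
Qed.

Lemma x_yz_min y z : let x := x_yz f h g p y z in X x /\
  forall u, X u -> Kfun f h p x z y <= Kfun f h p u z y.
Proof. exact: (argmin_spec X0 compactX (continuous_Kfun (y := y) (z := z))). Qed.

Lemma x_yz_optimality y z : optimality y z (x_yz f h g p y z).
Proof. by have [] := x_yz_min y z; exact: min_optimality. Qed.

Lemma h_gradient_le y x u : (forall i, 0 <= y 0 i) -> X x -> X u ->
  dot (y *m gradmx h x) (u - x) <= dot y (h u - h x).
Proof.
move=> y0 Xx Xu; rewrite dot_mulmx; apply: ler_sum => i _; rewrite ler_wpM2l//.
have := convex_gradient_le (h_conv i) Xx Xu (h_diff i Xx).
rewrite !mxE /component; congr (_ <= _); apply: eq_bigr => j _.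
by rewrite !mxE mulrC.
Qed.

(** Adding the two variational inequalities, each tested at the other point: the
    Lipschitz gradient of f costs at most Lf |x - x'|^2 out of the p |x - x'|^2
    brought by the regularization, and the convexity of h turns the terms in
    the multipliers into differences of values of h. *)
Lemma optimality_monotone y z x y' z' x' :
  (forall i, 0 <= y 0 i) -> (forall i, 0 <= y' 0 i) ->
  optimality y z x -> optimality y' z' x' ->
  mu * enorm (x - x') ^+ 2 <= p * dot (z - z') (x - x') + dot (y - y') (h x' - h x).
Proof.
move=> y0 y'0 [Xx ox] [Xx' ox'].
have := ox _ Xx'; have := ox' _ Xx; rewrite !dotDl !dotZl.
have := h_gradient_le y0 Xx Xx'; have := h_gradient_le y'0 Xx' Xx.
have := CauchySchwarz (grad f x' - grad f x) (x - x').
have := f_lip Xx' Xx; rewrite (enormB x' x).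
have := enorm_ge0 (x - x').
rewrite -(opprB x x') -(opprB (h x') (h x)) !dotNr !dotBl !dotNl /mu_K.
have -> : enorm (x - x') ^+ 2 = dot x (x - x') - dot x' (x - x').
  by rewrite sqr_enorm dotBl.
move: (sqr_enorm (x - x')); rewrite dotBl.
set e := enorm (x - x'); set e' := enorm (_ - grad f x).
nra.
Qed.

Lemma x_yz_lipschitz y y' z : (forall i, 0 <= y 0 i) -> (forall i, 0 <= y' 0 i) ->
  enorm (x_yz f h g p y z - x_yz f h g p y' z) <= kappa2 h g Lf p * enorm (y - y').
Proof.
move=> y0 y'0; have ox := x_yz_optimality y z; have ox' := x_yz_optimality y' z.
move: ox ox'; set x := x_yz _ _ _ _ y _; set x' := x_yz _ _ _ _ y' _ => ox ox'.
have := optimality_monotone y0 y'0 ox ox'; rewrite subrr dot0l mulr0 add0r.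
have := h_lipschitz ox'.1 ox.1; have := CauchySchwarz (y - y') (h x' - h x).
rewrite (enormB x' x) /kappa2 mulrAC ler_pdivlMr ?mu_gt0// => cs hle mono.
have K0 : 0 <= Kh := norm2_ge0 _.
apply: cancel_factor; rewrite ?mulr_ge0 ?enorm_ge0// mulrC.
apply: (le_trans mono); apply: (le_trans cs).
by rewrite -mulrA mulrCA ler_wpM2l ?enorm_ge0// (enormB (h x')).
Qed.

End Lagrangian.

(** * Saddle points over the box *)

Lemma le0_of_le_linear (R : realFieldType) (a C : R) :
  (forall t, 0 < t -> t <= 1 -> a <= t * C) -> a <= 0.
Proof.
move=> aC; rewrite leNgt; apply/negP => a0.
have C0 : 0 < C by have := aC 1 ltr01 (lexx _); lra.
have a2 : a <= C by have := aC 1 ltr01 (lexx _); lra.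
have := aC (a / (2 * C)); rewrite divr_gt0 ?mulr_gt0// => /(_ isT).
have -> : a / (2 * C) * C = a / 2 by field; lra.
rewrite ler_pdivrMr ?mulr_gt0//; lra.
Qed.

Section Saddle.
Context {R : realType} {n m l : nat}.
Variables (f : 'rV[R]_n -> R) (h : 'rV[R]_n -> 'rV[R]_m)
  (g : 'rV[R]_n -> 'rV[R]_l).
Variables (Lf : R) (Lh : 'I_m -> R) (Lg : 'I_l -> R) (p B : R).
Hypothesis A1 : assumption1 f h g Lf Lh Lg.
Hypothesis X0 : feasX g !=set0.
Hypothesis p_gt : Lf < p.
Hypothesis B_ge0 : 0 <= B.
Local Notation X := (feasX g).
Local Notation mu := (mu_K Lf p).
Local Notation Kh := (Kh h g).
Local Notation opt := (optimality f h g p).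
Implicit Types (x z u : 'rV[R]_n) (y : 'rV[R]_m).

Let compactX : compact X. Proof. by case: A1 => [[]]. Qed.

Lemma box_ge0 y : boxY B y -> forall i, 0 <= y 0 i.
Proof. by move=> yB i; case/andP: (yB i). Qed.

Definition saddle z x y := [/\ X x,
  forall u, X u -> Kfun f h p x z y <= Kfun f h p u z y, boxY B y &
  forall y', boxY B y' -> dot y' (h x) <= dot y (h x)].

Lemma saddle_optimality z x y : saddle z x y -> opt y z x.
Proof. by case=> Xx xmin _ _; exact: (min_optimality A1). Qed.

Lemma enorm_h_bounded : exists M, forall x, X x -> enorm (h x) <= M.
Proof.
case: X0 => a Xa; have [W _ XW] := compact_enorm_bounded compactX.
exists (Kh * W + enorm (h a)) => x Xx.
have := enormD (h x - h a) (h a); rewrite subrK.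
have := h_lipschitz A1 Xx Xa; have := XW _ _ Xx Xa.
have := norm2_ge0 (fun i => max_grad g (component h i)); rewrite -/Kh; nra.
Qed.

(** The multiplier maximizes over the box the dual function d(y), the minimum over X of
    the regularized Lagrangian at y.  For y' in the box and yt = y + t (y' - y), comparing
    d(yt) with d(y) gives <y' - y, h(x_yz yt)> <= 0, and x_yz yt tends to
    x_yz y with t. *)
Lemma saddle_exists z : exists y, saddle z (x_yz f h g p y z) y.
Proof.
have [M hM] := enorm_h_bounded.
pose d y := Kfun f h p (x_yz f h g p y z) z y.
have dK y y' : d y <= d y' + dot (y - y') (h (x_yz f h g p y' z)).
  have [Xy ymin] := x_yz_min p A1 X0 y z; have [Xy' _] := x_yz_min p A1 X0 y' z.
  by have := ymin _ Xy'; rewrite /d /Kfun dotBl; lra.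
have cd : continuous d.
  apply: (@lipschitz_enorm_continuous _ _ _ M) => y y'.
  have := dK y y'; have := CauchySchwarz (y - y') (h (x_yz f h g p y' z)).
  have := hM _ (x_yz_min p A1 X0 y' z).1; have := enorm_ge0 (y - y'); nra.
have Y0 : (boxY B : set 'rV[R]_m) !=set0 by exists 0; exact: boxY0.
have [y] := EVT_max_rV Y0 (@boxY_compact R m B) (continuous_subspaceT cd).
rewrite inE => yB ymax; exists y; have [Xy ymin] := x_yz_min p A1 X0 y z.
split=> // y' y'B.
suff : dot (y' - y) (h (x_yz f h g p y z)) <= 0 by rewrite dotBl; lra.
(* t C bounds the change of <y' - y, h(x_yz .)> between y and yt *)
pose C := enorm (y' - y) * (Kh * (kappa2 h g Lf p * enorm (y' - y))).
apply: (@le0_of_le_linear _ _ C) => t t0 t1.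
pose yt := y + t *: (y' - y).
have ytB : boxY B yt := convex_set_segment (@boxY_convex R m B) yB y'B (ltW t0) t1.
have := ymax yt; rewrite inE => /(_ ytB) dyt.
have := dK y yt; rewrite /yt opprD addNKr dotNl dotZl -/yt => dle.
have le0 : dot (y' - y) (h (x_yz f h g p yt z)) <= 0 by nra.
have [Xyt _] := x_yz_min p A1 X0 yt z.
have := CauchySchwarz (y' - y) (h (x_yz f h g p y z) - h (x_yz f h g p yt z)).
have := h_lipschitz A1 Xy Xyt.
have := x_yz_lipschitz A1 X0 p_gt z (box_ge0 yB) (box_ge0 ytB).
rewrite [in X in X -> _]/yt opprD addNKr enormN enormZ gtr0_norm// dotBr.
have := enorm_ge0 (y' - y); have K0 : 0 <= Kh := norm2_ge0 _.
rewrite /C; move: (enorm _) (enorm (x_yz _ _ _ _ _ _ - _)) (enorm (h _ - h _)).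
move=> e ex eh e0 exle ehle dle2.
have : Kh * ex <= Kh * (kappa2 h g Lf p * (t * e)) by rewrite ler_wpM2l.
move=> ?; have : e * eh <= e * (Kh * (kappa2 h g Lf p * (t * e))).
  by rewrite ler_wpM2l//; apply: le_trans ehle _.
nra.
Qed.

(** At a saddle point (x, y) the supremum over the box at x is the value at y, so a
    minimizer of the supremum also minimizes the Lagrangian at y; such a
    minimizer is unique. *)
Lemma x_z_saddle z : exists y, saddle z (x_z f h g p B z) y.
Proof.
have [y sad] := saddle_exists z; exists y.
suff -> : x_z f h g p B z = x_yz f h g p y z by [].
move: sad; set x := x_yz _ _ _ _ _ _ => sad.
have [Xx xmin yB ymax] := sad.
pose F u := sup [set Kfun f h p u z y | y in boxY B].
have ubF u : has_ubound [set Kfun f h p u z y | y in boxY B].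
  exists (f u + B * \sum_i `|h u 0 i| + p / 2 * enorm (u - z) ^+ 2) => _ [y' y'B <-].
  rewrite /Kfun lerD2r lerD2l mulr_sumr; apply: ler_sum => i _.
  case/andP: (y'B i) => y0 yb.
  apply: (le_trans (ler_norm _)); rewrite normrM ger0_norm//.
  by rewrite ler_wpM2r.
have Fx : F x <= Kfun f h p x z y.
  apply: ge_sup; first by exists (Kfun f h p x z y); exists y.
  by move=> _ [y' y'B <-]; rewrite /Kfun lerD2r lerD2l ymax.
have Fge u : Kfun f h p u z y <= F u by apply: ub_le_sup => //; exists y.
have Fmin u : X u -> F x <= F u.
  by move=> Xu; apply: (le_trans Fx); apply: le_trans (Fge u); exact: xmin.
have [Xw wmin] : X (x_z f h g p B z) /\ forall u, X u -> F (x_z f h g p B z) <= F u.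
  by rewrite /x_z /argmin; case: xgetP => [w _ //|/(_ x)[]].
have ow : opt y z (x_z f h g p B z).
  apply: (min_optimality A1) => // u Xu; apply: (le_trans (Fge _)).
  by apply: (le_trans (wmin x Xx)); apply: (le_trans Fx); exact: xmin.
have := optimality_monotone A1 (box_ge0 yB) (box_ge0 yB) ow (saddle_optimality sad).
rewrite !subrr dot0l mulr0 dot0l addr0 pmulr_rle0 ?mu_gt0// => e0.
apply/eqP; rewrite -subr_eq0 -enorm_eq0 -sqrf_eq0 eq_le e0 sqr_ge0//.
Qed.

Lemma x_z_lipschitz z z' :
  enorm (x_z f h g p B z - x_z f h g p B z') <= p / mu * enorm (z - z').
Proof.
have [y sad] := x_z_saddle z; have [y' sad'] := x_z_saddle z'.
have ow := saddle_optimality sad; have ow' := saddle_optimality sad'.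
case: sad sad' => _ _ yB ymax [_ _ y'B y'max].
move: (x_z f h g p B z) (x_z f h g p B z') => w w' in ow ow' ymax y'max *.
have mono := optimality_monotone A1 (box_ge0 yB) (box_ge0 y'B) ow ow'.
have p0 : 0 < p := lt_trans (Lf_gt0 A1) p_gt.
have le0 : dot (y - y') (h w' - h w) <= 0.
  by have := ymax _ y'B; have := y'max _ yB; rewrite dotBl !dotBr; lra.
rewrite mulrAC ler_pdivlMr ?mu_gt0//.
apply: cancel_factor; rewrite ?mulr_ge0 ?enorm_ge0 ?(ltW p0)// mulrC.
apply: (le_trans mono); rewrite -[leRHS]addr0 lerD// -mulrA ler_pM2l//.
exact: CauchySchwarz.
Qed.

End Saddle.

(** * Fixed points of the proximal map are stationary *)

Section Stationary.
Context {R : realType} {n m l : nat}.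
Variables (f : 'rV[R]_n -> R) (h : 'rV[R]_n -> 'rV[R]_m)
  (g : 'rV[R]_n -> 'rV[R]_l).
Variables (Lf : R) (Lh : 'I_m -> R) (Lg : 'I_l -> R) (p B : R).
Variables (xhat : 'rV[R]_n) (Delta0 : R).
Hypothesis A1 : assumption1 f h g Lf Lh Lg.
Hypothesis xhatX : feasX g xhat.
Hypothesis Delta0_gt0 : 0 < Delta0.
Hypothesis slater : forall i, h xhat 0 i <= - Delta0.
Hypothesis B_gt : max_grad g f * diamX g < B * Delta0.
Hypothesis B_ge0 : 0 <= B.

(** Testing optimality at the Slater point bounds the sum of the multipliers by
    max_grad f * diamX / Delta0 < B, so no multiplier is at the upper end
    of the box, and a violated constraint would put its multiplier there. *)
Lemma saddle_fixpoint_stationary z y : saddle f h g p B z z y -> stationary f h g z.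
Proof.
move=> sad; have [Xz zo] := saddle_optimality A1 sad.
have compactX : compact (feasX g) by case: A1 => [[]].
case: sad => _ _ yB ymax; have y0 := box_ge0 yB.
have comp_ge0 i : 0 <= y 0 i * h z 0 i.
  have /ymax : boxY B (update y i 0) by apply: boxY_update; rewrite ?lexx.
  rewrite dotC dot_update (dotC y); lra.
have lag u : feasX g u -> 0 <= dot (grad f z) (u - z) + dot (y *m gradmx h z) (u - z).
  by move=> /zo; rewrite subrr scaler0 addr0 dotDl.
have sum_lt : (\sum_i y 0 i) * Delta0 < B * Delta0.
  apply: le_lt_trans B_gt.
  have := lag _ xhatX; have := h_gradient_le A1 y0 Xz xhatX.
  have : dot y (h xhat - h z) <= - ((\sum_i y 0 i) * Delta0).
    rewrite mulr_suml -sumrN; apply: ler_sum => i _; rewrite !mxE.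
    by have := comp_ge0 i; have := slater i; have := y0 i; nra.
  have := CauchySchwarz (grad f z) (xhat - z).
  have f_lip : lipschitz_grad (feasX g) Lf f by case: A1 => _ [].
  have gle := enorm_le_max_grad compactX f_lip Xz.
  have dle := enorm_le_diamX compactX xhatX Xz.
  have := ler_pM (enorm_ge0 _) (enorm_ge0 _) gle dle; lra.
have y_lt i : y 0 i < B.
  rewrite ltr_pM2r// in sum_lt; apply: le_lt_trans sum_lt.
  by rewrite (bigD1 i)//= lerDl sumr_ge0.
have h_le0 i : h z 0 i <= 0.
  have /ymax : boxY B (update y i B) by apply: boxY_update; rewrite ?lexx ?B_ge0.
  by rewrite dotC dot_update (dotC y); have := y_lt i; nra.
split=> //; exists y; split=> //.
- exists (- (grad f z + y *m gradmx h z)); last by rewrite subrr.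
  by split=> // u Xu; rewrite dotNl dotDl; have := lag u Xu; lra.
- apply: le_anti; apply/andP; split.
    by apply: sumr_le0 => i _; rewrite mulr_ge0_le0.
  by apply: sumr_ge0 => i _; exact: comp_ge0.
Qed.

End Stationary.

(** * Uniform regularity near a stationary point *)

Lemma enorm_row_mx_l (R : realType) (m l : nat) (a : 'rV[R]_m) (b : 'rV[R]_l) :
  enorm a <= enorm (row_mx a b).
Proof.
apply: ler_wsqrtr; rewrite /dot big_split_ord/=.
rewrite [X in _ <= X + _](eq_bigr (fun i => a 0 i * a 0 i)) => [|i _]; last first.
  by rewrite row_mxEl.
by rewrite lerDl sumr_ge0// => i _; rewrite -expr2 sqr_ge0.
Qed.

Section Regularity.
Context {R : realType} {n m l : nat}.
Variables (f : 'rV[R]_n -> R) (h : 'rV[R]_n -> 'rV[R]_m)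
  (g : 'rV[R]_n -> 'rV[R]_l).
Variables (Lf : R) (Lh : 'I_m -> R) (Lg : 'I_l -> R).
Hypothesis A1 : assumption1 f h g Lf Lh Lg.
Hypothesis sigma_gt0 : (0 < sigma_star f h g)%E.
Local Notation X := (feasX g).
Local Notation s := (inv_sigma_star f h g).
Local Notation L := (Num.sqrt (norm2 Lh ^+ 2 + norm2 Lg ^+ 2)).
Local Notation J := (Jmx h g).

Lemma inv_sigma_star_ge0 : 0 <= s.
Proof.
rewrite /inv_sigma_star; case: (sigma_star f h g) sigma_gt0 => [r| |] //=.
by rewrite lte_fin => r0; rewrite inver gt_eqF//= invr_ge0 ltW.
Qed.

(** By [sigma_min_le] when the active set is nonempty.  Otherwise the only vector
    supported on it is 0; this covers sigma_star = +oo, where s = 0. *)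
Lemma supported_enorm_le xb w : stationary f h g xb ->
  supported_on (active h g xb) w -> enorm w <= s * enorm (w *m J xb).
Proof.
move=> st sw; have [A0|A0] := eqVneq (active h g xb) finset.set0.
  rewrite (_ : w = 0); first by rewrite enorm0 mulr_ge0 ?inv_sigma_star_ge0 ?enorm_ge0.
  by apply/rowP => j; rewrite mxE sw// A0 inE.
set S := active h g xb in A0 sw.
have : (sigma_star f h g <= (sigma_min (Jsub h g S xb)^T)%:E)%E.
  by apply: ereal_inf_lbound; exists xb, S.
rewrite /inv_sigma_star; case: (sigma_star f h g) sigma_gt0 => [r| |] //=.
rewrite lte_fin lee_fin => r0 rle; rewrite inver gt_eqF//= mulrC ler_pdivlMr// mulrC.
rewrite -(enorm_restrict sw) -(restrict_mulmx _ sw).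
by apply: le_trans (sigma_min_le _ _); rewrite ler_wpM2r ?enorm_ge0.
Qed.

Lemma Jmx_lipschitz x u w : X x -> X u ->
  enorm (w *m (J x - J u)) <= enorm w * (L * enorm (x - u)).
Proof.
move=> Xx Xu; apply: (le_trans (enorm_mulmx_le _ _)); rewrite ler_wpM2l ?enorm_ge0//.
case: A1 => [[_ _ Ag] _ Ah].
have := enorm_ge0 (x - u).
have [e eE] : exists e, e = enorm (x - u) by exists (enorm (x - u)).
rewrite -eE => e0.
rewrite -(ler_pXn2r (ltn0Sn 1)) ?nnegrE ?mulr_ge0 ?norm2_ge0 ?sqrtr_ge0//.
rewrite exprMn [L ^+ 2]sqr_sqrtr ?addr_ge0 ?sqr_ge0// !sqr_norm2 mulrDl !mulr_suml.
rewrite big_split_ord/=.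
have sq a b : 0 <= a -> a <= b * e -> a ^+ 2 <= b ^+ 2 * e ^+ 2.
  by move=> a0 ab; rewrite -exprMn ler_pXn2r ?nnegrE ?(le_trans a0).
apply: lerD; apply: ler_sum => i _; apply: sq; rewrite ?enorm_ge0//.
  by rewrite linearB/= /Jmx !rowKu !rowK eE; case: (Ah i) => _ _; apply.
by rewrite linearB/= /Jmx !rowKd !rowK eE; case: (Ag i) => _ _; apply.
Qed.

(** Replacing J xb by J x in [supported_enorm_le] costs at most s L |x - xb| |w|,
    hence at most half of |w|, which is absorbed in the left-hand side. *)
Lemma near_supported_enorm_le xb x w : stationary f h g xb -> X x ->
  s * L * enorm (x - xb) <= 1 / 2 ->
  supported_on (active h g xb) w -> enorm w <= 2 * s * enorm (w *m J x).
Proof.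
move=> st Xx xs sw; have := supported_enorm_le st sw.
have := Jmx_lipschitz w (st.1 : X xb) Xx; rewrite (enormB xb).
have := enormD (w *m (J xb - J x)) (w *m J x); rewrite -mulmxDr subrK.
have := enorm_ge0 w; have s0 := inv_sigma_star_ge0.
move: (enorm w) (enorm (w *m J x)) (enorm (w *m (_ - _))) (enorm (w *m J xb)) => a b c d.
move=> a0 dle cle ale.
have : s * d <= s * (c + b) by rewrite ler_wpM2l.
have : s * c <= s * (a * (L * enorm (x - xb))) by rewrite ler_wpM2l.
have : a * (s * L * enorm (x - xb)) <= a * (1 / 2) by rewrite ler_wpM2l.
lra.
Qed.

(** The margin eta on h leaves room for the distance between y and y+ in the
    argument that the multipliers of inactive constraints vanish; the last
    condition is what [near_supported_enorm_le] asks for. *)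
Definition regular_nbr xb eta x := [/\ X x,
  forall i, h xb 0 i != 0 -> h x 0 i < - eta,
  forall j, g xb 0 j != 0 -> g x 0 j < 0 &
  s * L * enorm (x - xb) <= 1 / 2].

Lemma regular_nbr_near xb : stationary f h g xb ->
  exists2 eta, 0 < eta & exists2 rho, 0 < rho &
    forall x, X x -> enorm (x - xb) < rho -> regular_nbr xb eta x.
Proof.
move=> [Xxb [_ [_ _ hle _]]].
have hc i : {for xb, continuous (component h i)}.
  by case: A1 => _ _ /(_ i)[_ [/(_ _ Xxb) d _] _]; exact: differentiable_continuous.
have gc j : {for xb, continuous (component g j)}.
  by case: A1 => [[_ _ /(_ j)[_ /(_ xb) d _]] _ _]; exact: differentiable_continuous.
have [eta [eta0 etah]] : exists eta : R, 0 < eta /\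
    forall i, h xb 0 i != 0 -> h xb 0 i < - eta.
  apply: (@filter_ex _ (at_right (0 : R))); near=> eta; split.
    by near: eta; exact: nbhs_right_gt.
  near: eta; apply: filter_forall => i.
  have [hi|hi] := boolP (h xb 0 i != 0); last by near=> eta.
  near=> eta => _; suff : eta < `|h xb 0 i| by rewrite ler0_norm ?hle//; lra.
  by near: eta; apply: nbhs_right_lt; rewrite normr_gt0.
exists eta => //.
have [rho rho0 near_xb] : exists2 rho : R, 0 < rho &
    forall x, enorm (x - xb) < rho ->
      [/\ forall i, h xb 0 i != 0 -> component h i x < - eta,
          forall j, g xb 0 j != 0 -> component g j x < 0 &
          enorm (x - xb) < (2 * (s * L + 1))^-1].
  apply: enorm_nbhs; near=> x; split.
  - near: x; apply: filter_forall => i.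
    have [hi|hi] := boolP (h xb 0 i != 0); last by near=> x.
    by near=> x => _; near: x; apply: (cvgr_lt _ (hc i)); exact: etah.
  - near: x; apply: filter_forall => j.
    have [gj|gj] := boolP (g xb 0 j != 0); last by near=> x.
    near=> x => _; near: x; apply: (cvgr_lt _ (gc j)).
    by rewrite lt_neqAle gj; exact: Xxb.
  - near: x; apply: near_enorm.
    by rewrite invr_gt0 mulr_gt0// ltr_wpDl// mulr_ge0 ?inv_sigma_star_ge0 ?sqrtr_ge0.
exists rho => // x Xx /near_xb[hx gx ex]; split=> //.
have sL : 0 <= s * L by rewrite mulr_ge0 ?inv_sigma_star_ge0 ?sqrtr_ge0.
have e0 := enorm_ge0 (x - xb).
rewrite -[_^-1]mul1r ltr_pdivlMr in ex; last by rewrite mulr_gt0// ltr_wpDl.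
move: ex; lra.
Unshelve. all: by end_near. Qed.

(** The normal vector in the optimality condition is a combination of the active
    constraint gradients of X, since these inherit linear independence from xb. *)
Lemma optimality_multiplier p y z x xb eta : stationary f h g xb ->
  regular_nbr xb eta x ->
  optimality f h g p y z x -> (forall i, h xb 0 i != 0 -> y 0 i = 0) ->
  exists2 w : 'rV[R]_l, supported_on (active h g xb) (row_mx y w) &
    row_mx y w *m J x = - (grad f x + p *: (x - z)).
Proof.
move=> st [Xx hx gx ex] [_ opt] y0.
have supp (u : 'rV[R]_m) (w : 'rV[R]_l) : (forall i, h xb 0 i != 0 -> u 0 i = 0) ->
    supported_on (active_ineq g x) w -> supported_on (active h g xb) (row_mx u w).
  move=> u0 w0 k; rewrite !inE negb_or => /andP[k1 k2].
  case: (splitP k) => [i ki|j kj].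
    have -> : k = lshift l i by apply: val_inj.
    rewrite row_mxEl u0//; apply: contra k1 => hi.
    by apply/imsetP; exists i; rewrite ?inE//; apply: val_inj.
  have kE : k = rshift m j by apply: val_inj.
  rewrite kE row_mxEr w0// inE; apply: contraNneq k2 => gj.
  rewrite kE; apply/imsetP; exists j; rewrite // inE.
  by apply/negPn/negP => /gx; rewrite gj ltxx.
have g_diff j : differentiable (component g j) x by case: A1 => [[_ _ /(_ j)[]]].
have [w w0 wE] : exists2 w, supported_on (active_ineq g x) w &
    - (grad f x + y *m gradmx h x + p *: (x - z)) = w *m gradmx g x.
  apply: normal_cone_span => //.
    move=> w w0 wJ.
    have sw : supported_on (active h g xb) (row_mx (0 : 'rV[R]_m) w).
      by apply: supp => // i _; rewrite mxE.
    have := near_supported_enorm_le st Xx ex sw.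
    rewrite /Jmx mul_row_col wJ mul0mx addr0 enorm0 mulr0 => w_le0.
    have /eqP : row_mx (0 : 'rV[R]_m) w == 0.
      by rewrite -enorm_eq0 eq_le w_le0 enorm_ge0.
    by rewrite -[0 in RHS]row_mx0 => /eq_row_mx[].
  by split=> // u Xu; rewrite dotNl oppr_le0; exact: opt.
exists w; first exact: supp.
by rewrite /Jmx mul_row_col -wE [grad f x + _]addrC -[_ + grad f x + _]addrA opprD addNKr.
Qed.

End Regularity.

(** * The dual error bound *)

Section ErrorBound.
Context {R : realType} {n m l : nat}.
Variables (f : 'rV[R]_n -> R) (h : 'rV[R]_n -> 'rV[R]_m)
  (g : 'rV[R]_n -> 'rV[R]_l).
Variables (Lf : R) (Lh : 'I_m -> R) (Lg : 'I_l -> R) (p B alpha : R).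
Hypothesis A1 : assumption1 f h g Lf Lh Lg.
Hypothesis X0 : feasX g !=set0.
Hypothesis p_gt : Lf < p.
Hypothesis alpha_gt0 : 0 < alpha.
Hypothesis B_ge0 : 0 <= B.
Hypothesis sigma_gt0 : (0 < sigma_star f h g)%E.
Local Notation X := (feasX g).
Local Notation mu := (mu_K Lf p).
Local Notation Kh := (Kh h g).
Local Notation s := (inv_sigma_star f h g).
Local Notation L := (Num.sqrt (norm2 Lh ^+ 2 + norm2 Lg ^+ 2)).
Local Notation J := (Jmx h g).
Local Notation xyz := (x_yz f h g p).
Local Notation yplus := (y_plus f h g p B alpha).
Local Notation C := (1 / alpha + Kh * kappa2 h g Lf p).
Implicit Types (x z u : 'rV[R]_n) (y : 'rV[R]_m).

Let compactX : compact X. Proof. by case: A1 => [[]]. Qed.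
Let f_lip : lipschitz_grad X Lf f. Proof. by case: A1 => _ []. Qed.
Let p_gt0 : 0 < p. Proof. exact: lt_trans (Lf_gt0 A1) p_gt. Qed.

Lemma kappa2_ge0 : 0 <= kappa2 h g Lf p.
Proof. by rewrite /kappa2 divr_ge0 ?norm2_ge0// ltW// mu_gt0. Qed.

Lemma residual_factor_ge0 : 0 <= C.
Proof.
by rewrite addr_ge0 ?divr_ge0 ?(ltW alpha_gt0)// mulr_ge0 ?norm2_ge0// kappa2_ge0.
Qed.

Lemma y_plus_spec y z : boxY B (yplus y z) /\ forall u : 'rV[R]_m, boxY B u ->
  dot (y + alpha *: h (xyz y z) - yplus y z) (u - yplus y z) <= 0.
Proof.
apply: euclid_proj_spec; [by exists 0; exact: boxY0|exact: boxY_compact|exact: boxY_convex].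
Qed.

(** A gradient step leaves y+ at distance |y - y+| from being a best response to x(y+, z),
    so comparing x(y+, z) with the saddle point costs a multiple of that residual. *)
Lemma residual_bound y z xs ys : boxY B y -> saddle f h g p B z xs ys ->
  mu * enorm (xyz (yplus y z) z - xs) ^+ 2 <=
    enorm (yplus y z - ys) * (C * enorm (y - yplus y z)).
Proof.
move=> yB sad; set yp := yplus y z; have [ypB ypmax] := y_plus_spec y z.
have os := saddle_optimality A1 sad; have [Xs _ ysB ysmax] := sad.
have op := x_yz_optimality p A1 X0 yp z.
have oa := x_yz_optimality p A1 X0 y z.
have := optimality_monotone A1 (box_ge0 ypB) (box_ge0 ysB) op os.
rewrite subrr dot0l mulr0 add0r => mono.
apply: (le_trans mono).
have := ypmax _ ysB; rewrite -/yp addrAC (dotDl (y - yp)) dotZl => pv.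
have le_s := ysmax _ ypB.
have cs1 := CauchySchwarz (yp - ys) (y - yp).
have cs2 := CauchySchwarz (yp - ys) (h (xyz y z) - h (xyz yp z)).
have hl := h_lipschitz A1 oa.1 op.1.
have xl := x_yz_lipschitz A1 X0 p_gt z (box_ge0 yB) (box_ge0 ypB).
have K0 : 0 <= Kh := norm2_ge0 _.
have e0 := enorm_ge0 (yp - ys).
have a1 : dot (h (xyz y z)) (ys - yp) <= alpha^-1 * dot (y - yp) (yp - ys).
  rewrite ler_pdivlMl// -(opprB yp ys) dotNr; move: pv.
  rewrite -(opprB yp ys) !dotNr; lra.
have a2 : enorm (yp - ys) * enorm (h (xyz y z) - h (xyz yp z)) <=
    enorm (yp - ys) * (Kh * (kappa2 h g Lf p * enorm (y - yp))).
  by rewrite ler_wpM2l//; apply: (le_trans hl); rewrite ler_wpM2l.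
have a3 : alpha^-1 * dot (y - yp) (yp - ys) <=
    alpha^-1 * (enorm (yp - ys) * enorm (y - yp)).
  by rewrite ler_pM2l ?invr_gt0// dotC.
have -> : dot (yp - ys) (h xs - h (xyz yp z)) =
    (dot yp (h xs) - dot ys (h xs)) + dot (yp - ys) (h (xyz y z) - h (xyz yp z)) +
    dot (h (xyz y z)) (ys - yp).
  by rewrite (dotC (h (xyz y z))) !dotBr !dotBl; ring.
rewrite div1r; lra.
Qed.

(** Regularity at xb turns |y+ - y*| into a multiple of |x(y+, z) - x(z)|: the multipliers
    are supported on the constraints active at xb, and subtracting the two optimality
    conditions expresses their difference, multiplied by the Jacobian at x(z), through
    Lipschitz quantities.  One factor |x(y+, z) - x(z)| then cancels in
    [residual_bound]. *)
Lemma error_bound_near_stationary xb eta y z xs ys : stationary f h g xb -> 0 < eta ->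
  boxY B y -> X z -> saddle f h g p B z xs ys ->
  enorm (y - yplus y z) <= alpha * eta ->
  regular_nbr f h g Lh Lg xb eta xs ->
  regular_nbr f h g Lh Lg xb eta (xyz (yplus y z) z) ->
  regular_nbr f h g Lh Lg xb eta (xyz y z) ->
  enorm (xyz (yplus y z) z - xs) <=
    kappa5 f h g Lf Lh Lg p alpha * enorm (y - yplus y z).
Proof.
move=> st eta0 yB Xz sad; set yp := yplus y z => small regs regp rega.
have [ypB ypmax] := y_plus_spec y z; have rb := residual_bound yB sad.
have os := saddle_optimality A1 sad; have [Xs _ ysB ysmax] := sad.
have op := x_yz_optimality p A1 X0 yp z.
rewrite -/yp in ypB ypmax rb.
have zeroB i (u : 'rV[R]_m) : boxY B u -> boxY B (update u i 0).
  by move=> uB; apply: boxY_update; rewrite ?lexx.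
(* comparing with the multiplier whose i-th entry is reset to 0 *)
have supp_s i : h xb 0 i != 0 -> ys 0 i = 0.
  case: regs => _ /(_ i) hs _ _ /hs hi.
  have := ysmax _ (zeroB i _ ysB); rewrite dotC dot_update (dotC ys).
  case/andP: (ysB i) => y0 _ ?.
  by apply: le_anti; rewrite y0 andbT; nra.
have supp_p i : h xb 0 i != 0 -> yp 0 i = 0.
  case: rega => _ /(_ i) ha _ _ /ha hi.
  have q_lt0 : (y + alpha *: h (xyz y z) - yp) 0 i < 0.
    have -> : (y + alpha *: h (xyz y z) - yp) 0 i = (y - yp) 0 i + alpha * h (xyz y z) 0 i.
      by rewrite !mxE; ring.
    have := coord_le_enorm (y - yp) i; have := ler_norm ((y - yp) 0 i).
    have : alpha * h (xyz y z) 0 i < alpha * (- eta) by rewrite ltr_pM2l.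
    move: small; lra.
  have := ypmax _ (zeroB i _ ypB).
  rewrite dotBr dot_update addrAC subrr add0r sub0r mulNr oppr_le0 nmulr_lge0//.
  by case/andP: (ypB i) => y0 _ le0; apply: le_anti; rewrite y0 le0.
have [wp sp Jp] := optimality_multiplier A1 sigma_gt0 st regp op supp_p.
have [ws ss Js] := optimality_multiplier A1 sigma_gt0 st regs os supp_s.
have Xp := op.1; move: (xyz yp z) => xp in op rb Jp Xp regp *.
set Wp := row_mx yp wp in sp Jp; set Ws := row_mx ys ws in ss Js.
have s0 := inv_sigma_star_ge0 sigma_gt0.
have L0 : 0 <= L := sqrtr_ge0 _.
have Wp_le : enorm Wp <= 2 * s * (max_grad g f + p * diamX g).
  have [_ _ _ regp4] := regp.
  apply: (le_trans (near_supported_enorm_le A1 sigma_gt0 st Xp regp4 sp)).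
  rewrite ler_wpM2l ?mulr_ge0// Jp enormN.
  apply: (le_trans (enormD _ _)); rewrite lerD ?(enorm_le_max_grad compactX f_lip)//.
  by rewrite enormZ gtr0_norm// ler_pM2l// enorm_le_diamX.
pose e := enorm (xp - xs).
have dW_le : enorm (Wp - Ws) <= 2 * s * ((Lf + p + enorm Wp * L) * e).
  have [_ _ _ regs4] := regs.
  apply: (le_trans (near_supported_enorm_le A1 sigma_gt0 st Xs regs4 (supportedB sp ss))).
  rewrite ler_wpM2l ?mulr_ge0//.
  have -> : (Wp - Ws) *m J xs =
      - ((grad f xp - grad f xs) + p *: (xp - xs)) - Wp *m (J xp - J xs).
    rewrite mulmxBl mulmxBr Jp Js !scalerBr.
    apply/rowP => i; rewrite !mxE; ring.
  apply: (le_trans (enormD _ _)); rewrite !enormN mulrDl lerD//.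
    apply: (le_trans (enormD _ _)); rewrite mulrDl enormZ gtr0_norm// lerD//.
    exact: f_lip.
  by rewrite -mulrA; exact: (Jmx_lipschitz A1).
have dy_le : enorm (yp - ys) <= enorm (Wp - Ws).
  by rewrite /Wp /Ws opp_row_mx add_row_mx; exact: enorm_row_mx_l.
have e0 : 0 <= e := enorm_ge0 _.
have C0 := residual_factor_ge0.
have r0 : 0 <= enorm (y - yp) := enorm_ge0 _.
have Lf0 := Lf_gt0 A1; have mu0 := mu_gt0 p_gt.
pose Q := Lf + p + (2 * max_grad g f + 2 * p * diamX g) * s * L.
have Q_ge : Lf + p + enorm Wp * L <= Q.
  rewrite lerD2l ler_wpM2r//; apply: (le_trans Wp_le); lra.
have Q0 : 0 <= Q by apply: le_trans Q_ge; rewrite !addr_ge0 ?mulr_ge0 ?enorm_ge0// ltW.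
have dy_le2 : enorm (yp - ys) <= 2 * s * (Q * e).
  apply: (le_trans dy_le); apply: (le_trans dW_le).
  by rewrite ler_wpM2l ?mulr_ge0// ler_wpM2r.
have -> : kappa5 f h g Lf Lh Lg p alpha * enorm (y - yp) =
    (2 * s * Q * (C * enorm (y - yp))) / mu.
  by rewrite /kappa5 -/Q; ring.
rewrite -/e ler_pdivlMr//; apply: cancel_factor => //.
  by rewrite !mulr_ge0.
rewrite mulrC; apply: (le_trans rb).
have : 0 <= C * enorm (y - yp) by rewrite mulr_ge0.
move: (C * enorm (y - yp)) => c c0.
have := ler_wpM2r c0 dy_le2; lra.
Qed.

(** If xb is not a fixed point of the proximal map, the residual |z - x(z)| is bounded
    away from 0 near xb and a small delta excludes it; otherwise xb is stationary
    and all three points x(z), x(y+, z), x(y, z) are close to xb, the second by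
    [residual_bound], whose right-hand side is of order delta as the box is
    bounded. *)
Lemma error_bound_near xb : X xb ->
  (forall z y, saddle f h g p B z z y -> stationary f h g z) ->
  \forall z \near xb & delta \near (0 : R)^'+, X z ->
    forall y, boxY B y ->
    Num.max (enorm (y - yplus y z)) (enorm (z - x_z f h g p B z)) <= delta ->
    enorm (xyz (yplus y z) z - x_z f h g p B z)
      <= kappa5 f h g Lf Lh Lg p alpha * enorm (y - yplus y z).
Proof.
move=> Xxb fix_stat.
set xz := x_z f h g p B.
have mu0 := mu_gt0 p_gt.
have k0 : 0 <= p / mu by rewrite divr_ge0// ltW.
have xz_near (e : R) : 0 < e -> \forall z \near xb, enorm (xz z - xz xb) < e.
  move=> e0; near=> z.
  apply: (le_lt_trans (x_z_lipschitz A1 X0 p_gt B_ge0 z xb)).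
  have : enorm (z - xb) < e / (p / mu + 1).
    by near: z; apply: near_enorm; rewrite divr_gt0// ltr_wpDl.
  rewrite ltr_pdivlMr ?ltr_wpDl//; have := enorm_ge0 (z - xb); nra.
have [xbE|] := eqVneq (xb - xz xb) 0; last first.
  rewrite -enorm_eq0 => r_neq0.
  have r0 : 0 < enorm (xb - xz xb) by rewrite lt_neqAle eq_sym r_neq0 enorm_ge0.
  clearbody xz; have [r rE] : exists r, r = enorm (xb - xz xb) by eexists.
  rewrite -rE in r0.
  near=> z delta => /= Xz y yB; rewrite ge_max => /andP[_].
  have : delta < r / 3 by near: delta; apply: nbhs_right_lt; rewrite divr_gt0.
  have : enorm (z - xb) < r / 3 by near: z; apply: near_enorm; rewrite divr_gt0.
  have : enorm (xz z - xz xb) < r / 3 by near: z; apply: xz_near; rewrite divr_gt0.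
  have := enorm_triangle z xb (xz xb); have := enorm_triangle (xz z) z (xz xb).
  rewrite (enormB xb z) -rE; lra.
have {}xbE : xz xb = xb by apply/esym/eqP; rewrite -subr_eq0 xbE.
have st : stationary f h g xb.
  have [y sad] := x_z_saddle A1 X0 p_gt B_ge0 xb.
  by apply: (fix_stat _ y); rewrite -/xz xbE in sad.
have [eta eta0 [rho rho0 reg]] := regular_nbr_near A1 sigma_gt0 st.
have [W W0 YW] := compact_enorm_bounded (@boxY_compact R m B).
have C0 := residual_factor_ge0; have k20 := kappa2_ge0.
near=> z delta => /= Xz y yB; rewrite ge_max => /andP[ydelta zdelta].
have [ys sad] := x_z_saddle A1 X0 p_gt B_ge0 z.
have [ypB _] := y_plus_spec y z; have [Xs _ ysB _] := sad.
have rb := residual_bound yB sad; rewrite -/xz in rb Xs sad *.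
set yp := yplus y z in ydelta ypB rb *.
have s_near : enorm (xz z - xb) < rho / 4.
  by rewrite -xbE; near: z; apply: xz_near; rewrite divr_gt0.
have delta0 : 0 < delta by near: delta; exact: nbhs_right_gt.
have p_near : enorm (xyz yp z - xz z) < rho / 4.
  rewrite -(ltr_pXn2r (ltn0Sn 1)) ?nnegrE ?enorm_ge0 ?divr_ge0 ?(ltW rho0)//.
  rewrite -(ltr_pM2l mu0); apply: (le_lt_trans rb).
  have d1 : delta < mu * (rho / 4) ^+ 2 / (W * C + 1).
    near: delta; apply: nbhs_right_lt.
    by rewrite divr_gt0 ?mulr_gt0 ?exprn_gt0 ?divr_gt0// ltr_wpDl ?mulr_ge0.
  rewrite ltr_pdivlMr ?ltr_wpDl ?mulr_ge0// in d1; apply: le_lt_trans d1.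
  apply: (@le_trans _ _ (W * (C * delta))).
    by rewrite ler_pM ?enorm_ge0 ?mulr_ge0 ?enorm_ge0// ?YW// ler_wpM2l.
  by rewrite mulrA mulrC ler_pM2l// lerDl.
have a_near : enorm (xyz y z - xyz yp z) < rho / 4.
  apply: (le_lt_trans (x_yz_lipschitz A1 X0 p_gt z (box_ge0 yB) (box_ge0 ypB))).
  have d2 : delta < rho / 4 / (kappa2 h g Lf p + 1).
    by near: delta; apply: nbhs_right_lt; rewrite !divr_gt0// ltr_wpDl.
  rewrite ltr_pdivlMr ?ltr_wpDl// in d2; apply: le_lt_trans d2.
  apply: (@le_trans _ _ (kappa2 h g Lf p * delta)); first by rewrite ler_wpM2l.
  by rewrite mulrC ler_pM2l// lerDl.
have tri1 := enorm_triangle (xz z) (xyz yp z) xb.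
have tri2 := enorm_triangle (xyz yp z) (xyz y z) xb.
have Xa := (x_yz_optimality p A1 X0 y z).1; have Xp := (x_yz_optimality p A1 X0 yp z).1.
apply: (error_bound_near_stationary st eta0 yB Xz sad).
- apply: (le_trans ydelta); near: delta; apply: nbhs_right_le; exact: mulr_gt0.
- by apply: reg => //; move: s_near; lra.
- by apply: reg => //; move: s_near p_near tri1; lra.
- by apply: reg => //; move: s_near p_near a_near tri1 tri2; lra.
Unshelve. all: by end_near. Qed.

End ErrorBound.

Lemma SPLM_invariant (R : realType) (n m l : nat)
    (f : 'rV[R]_n -> R) (h : 'rV[R]_n -> 'rV[R]_m) (g : 'rV[R]_n -> 'rV[R]_l)
    (alpha beta c p B : R) (x z : nat -> 'rV[R]_n) (y : nat -> 'rV[R]_m) :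
  compact (feasX g) -> convex_set (feasX g) -> 0 <= B -> 0 <= beta <= 1 ->
  SPLM f h g alpha beta c p B x z y -> forall t, feasX g (z t) /\ boxY B (y t).
Proof.
move=> cX convX B0 /andP[b0 b1] [x0X z0X y0B step]; elim=> [//|t [zX yB]].
have [-> -> ->] := step t; split; last first.
  by apply: (euclid_proj_spec _ _ _ _).1;
    [exists 0; exact: boxY0|exact: boxY_compact|exact: boxY_convex].
apply: convex_set_segment => //.
by apply: (euclid_proj_spec _ _ _ _).1 => //; exists (x 0%N).
Qed.

Theorem proposition1 (R : realType) (n m l : nat)
    (f : 'rV[R]_n -> R) (h : 'rV[R]_n -> 'rV[R]_m) (g : 'rV[R]_n -> 'rV[R]_l)
    (Lf : R) (Lh : 'I_m -> R) (Lg : 'I_l -> R)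
    (xhat : 'rV[R]_n) (Delta0 : R) (p alpha B : R)
    (A1 : assumption1 f h g Lf Lh Lg)
    (Cpos : constants_pos f h g Lh Lg)
    (A2 : assumption2 f h g xhat Delta0)
    (p_gt : Lf < p) (alpha_gt0 : 0 < alpha)
    (B_gt : Num.max
              ((4 * max_grad g f * diamX g + 2 * p * diamX g ^+ 2) / Delta0)
              ((2 * max_grad g f + 2 * p * diamX g) * inv_sigma_star f h g) < B) :
  exists2 delta : R, 0 < delta &
    forall (c beta : R) (x z : nat -> 'rV[R]_n) (y : nat -> 'rV[R]_m),
      0 < c -> 0 < beta <= 1 / (24 * kappa1 Lf p) ->
      SPLM f h g alpha beta c p B x z y ->
      forall t : nat,
        let yp := y_plus f h g p B alpha (y t) (z t) in
        let xz := x_z f h g p B (z t) in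
        Num.max (enorm (y t - yp)) (enorm (z t - xz)) <= delta ->
        enorm (x_yz f h g p yp (z t) - xz)
          <= kappa5 f h g Lf Lh Lg p alpha * enorm (y t - yp).
Proof.
have [xhatX D0 slater sigma_gt0] := A2.
have [gf0 diam0 _ _ _] := Cpos.
have Lf0 := Lf_gt0 A1; have p0 : 0 < p := lt_trans Lf0 p_gt.
have [[convX cX _] _ _] := A1.
have X0 : feasX g !=set0 by exists xhat.
move: B_gt; rewrite gt_max => /andP[]; rewrite ltr_pdivrMr// => B_gt _.
have gd0 : 0 < max_grad g f * diamX g by rewrite mulr_gt0.
have pd0 : 0 < p * diamX g ^+ 2 by rewrite mulr_gt0 ?exprn_gt0.
have B_gt1 : max_grad g f * diamX g < B * Delta0 by move: B_gt; lra.
have B0 : 0 <= B.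
  by rewrite -(pmulr_lge0 _ D0) ltW// (lt_trans gd0).
have fix_stat := saddle_fixpoint_stationary A1 xhatX D0 slater B_gt1 B0.
have /compact_near_coveringP/near_covering_withinP cov := cX.
pose bound (delta : R) (z : 'rV[R]_n) := forall y, boxY B y ->
  Num.max (enorm (y - y_plus f h g p B alpha y z))
          (enorm (z - x_z f h g p B z)) <= delta ->
  enorm (x_yz f h g p (y_plus f h g p B alpha y z) z - x_z f h g p B z)
    <= kappa5 f h g Lf Lh Lg p alpha * enorm (y - y_plus f h g p B alpha y z).
have near_delta : \forall delta \near (0 : R)^'+, feasX g `<=` bound delta.
  apply: cov => xb Xxb.
  exact: (error_bound_near A1 X0 p_gt alpha_gt0 B0 sigma_gt0 Xxb (fix_stat p)).
have [delta [delta0 Hdelta]] : exists delta : R, 0 < delta /\ feasX g `<=` bound delta.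
  apply: (@filter_ex _ (at_right (0 : R))).
  by apply: filterI; [exact: nbhs_right_gt|exact: near_delta].
exists delta => // c beta x z y _ /andP[beta0 beta_le] splm t yp xz.
have beta1 : 0 <= beta <= 1.
  rewrite ltW//=; apply: (le_trans beta_le).
  have mu0 : 0 < mu_K Lf p := mu_gt0 p_gt.
  have k1 : 1 <= kappa1 Lf p by rewrite ler_pdivlMr// mul1r /mu_K; lra.
  rewrite ler_pdivrMr; lra.
have [Xz yB] := SPLM_invariant cX convX B0 beta1 splm t.
exact: Hdelta.
Qed.
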